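(* Let $r,s\ge0$ be integers, let $x,y$ be distinct vertices of $B_{r,s}=P_3^{\square r}\square Q_s$, and assume that $H=B_{r,s}-\{x,y\}$ is nonempty and is an isometric subgraph of $B_{r,s}$. Write $p=p(x,y)$, $q=q(x,y)$. (1) $H$ is a daisy cube if and only if either (a) $x,y$ are corners and $q=0$ or $(p,q)=(0,1)$; or (b) $(r,s)=(1,0)$ and $\{x,y\}$ is a boundary $P_3$-edge. (2) $H$ is a minimal forbidden pc-minor for daisy cubes if and only if either (a) $x,y$ are opposite corners, $s\ge1$, and $2r+s\ge3$; or (b) $(r,s)=(1,1)$ and $\{x,y\}$ is a boundary $P_3$-edge. In particular, every minimal forbidden pc-minor occurring in (2) is isomorphic to a graph obtained by deleting two opposite corners from some $B_{r',s'}$.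
   Context: Graphs are finite and simple; partial cubes are connected by convention. $P_3$ is the path on three vertices, $Q_s$ the hypercube on $\{0,1\}^s$, $\square$ the Cartesian product, $G^{\square0}=Q_0=K_1$. Coordinate model: $V(B_{r,s})=\{0,1,2\}^r\times\{0,1\}^s$, two vertices being adjacent iff they differ in exactly one coordinate and there by exactly $1$. The first $r$ coordinates are the $P_3$-coordinates, the last $s$ the binary coordinates. A corner is a vertex all of whose $P_3$-coordinates lie in $\{0,2\}$. For vertices $x,y$: $p(x,y)=|\{i\in[r]:\{x_i,y_i\}=\{0,2\}\}|$ and $q(x,y)=|\{j\in[s]:x_{r+j}\ne y_{r+j}\}|$. Two corners are opposite if $p=r$ and $q=s$. $\{x,y\}$ is a boundary $P_3$-edge if $x,y$ are adjacent, differ in a $P_3$-coordinate, and one of them is a corner. $B_{r,s}-\{x,y\}$ is the subgraph induced by the remaining vertices. A subgraph $H$ of $G$ is isometric if $d_H(u,v)=d_G(u,v)$ for all $u,v\in V(H)$. A partial cube is a graph isomorphic to an isometric subgraph of a hypercube. A daisy cube is a graph isomorphic to the induced subgraph $Q_n[D]$ for some $n\ge0$ and nonempty down-set $D\subseteq\{0,1\}^n$ (coordinatewise order). In a partial cube, $ab\,\Theta\,uv$ iff $d(a,u)+d(b,v)\ne d(a,v)+d(b,u)$; this is an equivalence relation on edges, and each class ($\Theta$-class) determines two complementary halfspaces $\{z:d(a,z)<d(b,z)\}$, $\{z:d(b,z)<d(a,z)\}$. A restriction of a partial cube is the subgraph induced by a halfspace of a $\Theta$-class; a contraction is obtained by contracting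 all edges of one $\Theta$-class (suppressing loops and parallel edges). A pc-minor is any graph obtained by a finite sequence of restrictions and contractions; it is proper if not isomorphic to the original graph. A minimal forbidden pc-minor for daisy cubes is a partial cube that is not a daisy cube but all of whose proper pc-minors are daisy cubes. *)

(* Defs.v *)
From mathcomp Require Import all_boot.

Set Implicit Arguments.
Unset Strict Implicit.
Unset Printing Implicit Defensive.

Record sgraph := SGraph {
  vertex :> finType;
  edge : rel vertex;
  edge_sym : symmetric edge;
  edge_irr : irreflexive edge }.

Arguments edge {s} _ _.

Definition isomorphic (G H : sgraph) : Prop :=
  exists f : G -> H, bijective f /\ forall u v : G, edge (f u) (f v) = edge u v.

Definition is_connected (G : sgraph) : Prop :=
  0 < #|G| /\ forall u v : G, connect edge u v.

Section Induced.
Variables (G : sgraph) (A : {set G}).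

Definition induced_edge : rel {v : G | v \in A} :=
  fun u v => edge (val u) (val v).

Fact induced_edge_sym : symmetric induced_edge.
Proof. by move=> u v; apply: edge_sym. Qed.

Fact induced_edge_irr : irreflexive induced_edge.
Proof. by move=> u; apply: edge_irr. Qed.

Definition induced : sgraph := SGraph induced_edge_sym induced_edge_irr.

End Induced.

Section Distance.
Variable G : sgraph.

Definition walk (n : nat) (u v : G) : bool :=
  [exists t : n.-tuple G, path edge u t && (last u t == v)].

(* The distance, [None] standing for infinity; a shortest walk has fewer than
   #|G| edges. *)
Definition dist (u v : G) : option nat :=
  ohead [seq n <- iota 0 #|G| | walk n u v].

(* Only used for connected graphs, where the default value is never reached. *)
Definition distn (u v : G) : nat := odflt #|G| (dist u v).

End Distance.

(* [H], seen through [f], is an isometric subgraph (not a priori induced)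
   of [G]. *)
Definition isometric_subgraph (H G : sgraph) (f : H -> G) : Prop :=
  [/\ injective f,
      forall u v : H, edge u v -> edge (f u) (f v)
    & forall u v : H, dist u v = dist (f u) (f v)].

Section Hypercube.
Variable n : nat.

Definition cube_edge : rel {ffun 'I_n -> bool} :=
  fun u v => #|[set i | u i != v i]| == 1.

Fact cube_edge_sym : symmetric cube_edge.
Proof.
move=> u v; rewrite /cube_edge /=; congr (_ == _); apply: eq_card => i.
by rewrite !inE eq_sym.
Qed.

Fact cube_edge_irr : irreflexive cube_edge.
Proof. by move=> u; rewrite /cube_edge /= eq_card0 // => i; rewrite !inE eqxx. Qed.

Definition hypercube : sgraph := SGraph cube_edge_sym cube_edge_irr.

Definition down_set (D : {set hypercube}) : Prop :=
  forall u v : hypercube, v \in D -> (forall i, u i <= v i) -> u \in D.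

End Hypercube.

Definition is_partial_cube (G : sgraph) : Prop :=
  is_connected G /\
  exists n (f : G -> hypercube n), isometric_subgraph f.

Definition is_daisy_cube (G : sgraph) : Prop :=
  exists n (D : {set hypercube n}),
    [/\ D != set0, down_set D & isomorphic G (induced D)].

Section ThetaClasses.
Variable G : sgraph.

Definition theta (a b u v : G) : bool :=
  distn a u + distn b v != distn a v + distn b u.

(* The other halfspace of the class of ab is [halfspace b a]. *)
Definition halfspace (a b : G) : {set G} := [set z | distn a z < distn b z].

Definition restriction (a b : G) : sgraph := induced (halfspace a b).

Definition theta_class (a b : G) : rel G :=
  fun u v => edge u v && theta a b u v.

(* The vertices of the contraction are the connected components of the graph
   formed by the edges of the class. *)
Definition contraction_blocks (a b : G) : {set {set G}} :=
  equivalence_partition (connect (theta_class a b)) [set: G].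

Definition contraction_edge (a b : G) :
    rel {A : {set G} | A \in contraction_blocks a b} :=
  fun A B => (A != B) &&
    [exists u in val A, exists v in val B, edge u v].

Fact contraction_edge_sym (a b : G) : symmetric (contraction_edge (a:=a) (b:=b)).
Proof.
move=> A B; rewrite /contraction_edge /= eq_sym; congr (_ && _).
by apply/exists_inP/exists_inP => -[u uA /exists_inP[v vB uv]];
  exists v => //; apply/exists_inP; exists u => //; rewrite edge_sym.
Qed.

Fact contraction_edge_irr (a b : G) :
  irreflexive (contraction_edge (a:=a) (b:=b)).
Proof. by move=> A; rewrite /contraction_edge /= eqxx. Qed.

Definition contraction (a b : G) : sgraph :=
  SGraph (@contraction_edge_sym a b) (@contraction_edge_irr a b).

End ThetaClasses.

Inductive pc_minor (G : sgraph) : sgraph -> Prop :=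
| pc_minor_refl : pc_minor G G
| pc_minor_restriction (M : sgraph) (a b : M) :
    pc_minor G M -> edge a b -> pc_minor G (restriction a b)
| pc_minor_contraction (M : sgraph) (a b : M) :
    pc_minor G M -> edge a b -> pc_minor G (contraction a b).

Definition minimal_forbidden_pc_minor (G : sgraph) : Prop :=
  [/\ is_partial_cube G,
      ~ is_daisy_cube G
    & forall M : sgraph,
        pc_minor G M -> ~ isomorphic M G -> is_daisy_cube M].

Section P3CubeProduct.
Variables r s : nat.

Let V : finType := ({ffun 'I_r -> 'I_3} * {ffun 'I_s -> bool})%type.

Definition coord (x : V) (k : 'I_r + 'I_s) : nat :=
  match k with inl i => x.1 i | inr j => x.2 j end.

Definition B_edge : rel V :=
  fun x y => [exists k,
     ((coord x k == (coord y k).+1) || (coord y k == (coord x k).+1)) &&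
     [forall l, (l != k) ==> (coord x l == coord y l)]].

Fact B_edge_sym : symmetric B_edge.
Proof.
move=> x y; apply: eq_existsb => k; rewrite orbC; congr (_ && _).
by apply: eq_forallb => l; rewrite [coord x l == _]eq_sym.
Qed.

Fact B_edge_irr : irreflexive B_edge.
Proof.
move=> x; apply/negbTE/existsPn => k.
by rewrite orbb -[X in X == _]addn0 -addn1 eqn_add2l.
Qed.

Definition B : sgraph := SGraph B_edge_sym B_edge_irr.

Definition corner (x : B) : Prop :=
  forall i : 'I_r, x.1 i \in [set ord0; ord_max].

Definition p_diff (x y : B) : nat :=
  #|[set i : 'I_r | [set x.1 i; y.1 i] == [set ord0; ord_max]]|.

Definition q_diff (x y : B) : nat := #|[set j : 'I_s | x.2 j != y.2 j]|.

Definition opposite_corners (x y : B) : Prop :=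
  [/\ corner x, corner y, p_diff x y = r & q_diff x y = s].

Definition boundary_P3_edge (x y : B) : Prop :=
  [/\ edge x y, exists i : 'I_r, x.1 i != y.1 i & corner x \/ corner y].

End P3CubeProduct.

Definition delete2 (G : sgraph) (x y : G) : sgraph := induced (~: [set x; y]).

(* Main.v *)
Require Import Defs.
From mathcomp Require Import all_boot zify.

Set Implicit Arguments.
Unset Strict Implicit.
Unset Printing Implicit Defensive.

(** Everything is carried out in hypercubes. A map [phi] from a graph to words
over a finite set [K] of coordinates is [cubical] when the distance of the graph
is the Hamming distance of the words. For such a map a Theta-class is a
coordinate [k], a restriction is the set of vertices with a given letter at [k],
and a contraction forgets [k] ([theta_coord], [cubical_restriction],
[contraction_edgeE]). A graph is a daisy cube exactly when some cubical image is
star-shaped about one of its words [c]: with a word it contains all words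
between it and [c] ([daisy_of_star], [star_of_daisy]). This form is visibly
stable under pc-minors ([restriction_closed], [contraction_closed]), so a graph
that is not a daisy cube is minimal as soon as its minors reached in one step
are daisy cubes ([minimal_forbiddenI]).

Being star-shaped does not depend on the embedding in the following sense
([star_flip]): in any cubical image of a daisy cube, every vertex can be moved
one step towards the centre in each coordinate where it differs from the centre.
Hence for each coordinate [l] one of the two letters is such that all vertices
with this letter can be flipped at [l]. So two vertices with different letters
at [l], neither of which can be flipped there, show that a graph is not a daisy
cube ([not_daisy]), and even that it is not minimal if both survive in some
restriction ([not_minimal]).

The graph [B r s] is cubical through [code], which writes the values 0, 1, 2 of
a ternary coordinate as 10, 00, 01. If deleting [x] and [y] is isometric, then a
ternary coordinate 1 of [x] forces [y] to be one of the two neighbours of [x] in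
this coordinate, because those have no common neighbour but [x]. Hence [x] and
[y] are corners, or they form a boundary edge ([omits_cases]).

If [x] and [y] are corners and the condition of the first part holds, then the
remaining graph is star-shaped about the vertex whose ternary coordinates are 1
and whose bits are the complements of those of [x] ([corners_daisy]). Otherwise
they differ in some bit, and the neighbours of [x] and of [y] obtained by
flipping this bit are the obstruction of [not_daisy]; it survives in a
restriction as soon as [x] and [y] agree in some coordinate
([corners_not_daisy], [corners_minimal]). For opposite corners, each restriction
contains just one of [x] and [y], each contraction fills in at least one of the
gaps, and suitable centres show that these minors are daisy cubes
([opposite_minimal]).

If [y] is a corner and [x] its neighbour with ternary coordinate 1, the
obstruction is given by the other neighbour of [x] in this coordinate together
with any further vertex on the side of [y] ([edge_not_daisy],
[edge_not_minimal]). In [B 1 1] the four remaining vertices form a path, which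
is also what two opposite corners leave there, and this case reduces to that of
opposite corners ([omits_edge11]). *)

(** * Walks and distances *)

Section Walks.
Variable G : sgraph.
Implicit Types u v w : G.

Lemma walkP n u v :
  reflect (exists t, [/\ size t = n, path edge u t & last u t = v])
          (walk n u v).
Proof.
apply: (iffP existsP) => [[t /andP[pt /eqP lt]]|[t [<- pt lt]]].
  by exists t; rewrite size_tuple.
by exists (in_tuple t); rewrite /= pt lt eqxx.
Qed.

Lemma walk0 u v : walk 0 u v -> u = v.
Proof. by case/walkP => -[|w t] [] // _ _ <-. Qed.

Lemma walk1 u v : walk 1 u v = edge u v.
Proof.
apply/walkP/idP => [[[|w [|w' t]] [//= _ uw <-]]|uv].
  by case/andP: uw.
by exists [:: v]; rewrite /= uv.
Qed.

Lemma walkS n u v :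
  walk n.+1 u v -> exists2 w, edge u w & walk n w v.
Proof.
case/walkP => -[|w t] [] //= [<-] /andP[uw pt] lt; exists w => //.
by apply/walkP; exists t.
Qed.

Lemma walk_connect n u v : walk n u v -> connect edge u v.
Proof. by case/walkP=> t [_ pt lt]; apply/connectP; exists t. Qed.

Lemma dist_sorted u v :
  sorted leq [seq n <- iota 0 #|G| | walk n u v].
Proof. by apply: sorted_filter (iota_sorted _ _); apply: leq_trans. Qed.

Lemma distP u v d : dist u v = Some d ->
  walk d u v /\ forall m, walk m u v -> d <= m.
Proof.
have := dist_sorted u v; rewrite /dist.
case def_t: filter => [//|d' t] /= sorted_t [eq_d]; rewrite {}eq_d in def_t sorted_t.
have: d \in d :: t by apply: mem_head.
rewrite -def_t mem_filter mem_iota => /and3P[wd _ ltd]; split=> // m wm.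
case: (ltnP m #|G|) => [ltm|/(leq_trans ltd)/ltnW //].
have: m \in d :: t by rewrite -def_t mem_filter wm mem_iota.
rewrite inE => /orP[/eqP->//|]; move: m {wm ltm}; apply/allP.
exact: (order_path_min leq_trans).
Qed.

Lemma distI u v d : d < #|G| -> walk d u v ->
  (forall m, walk m u v -> d <= m) -> dist u v = Some d.
Proof.
move=> ltd wd min_d; have := dist_sorted u v; rewrite /dist.
have: d \in [seq n <- iota 0 #|G| | walk n u v].
  by rewrite mem_filter wd mem_iota.
case def_t: filter => [//|d' t] /= d_in sorted_t; congr Some; apply/eqP.
rewrite eqn_leq; apply/andP; split.
  move: d_in; rewrite inE => /orP[/eqP->//|]; move: d {ltd wd min_d}.
  by apply/allP; apply: (order_path_min leq_trans).
apply: min_d; have: d' \in d' :: t by apply: mem_head.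
by rewrite -def_t mem_filter => /andP[].
Qed.

(** A potential that edges change by at most one, and that some edge decreases
whenever it is not yet zero, is the distance to [v]: descending along it is a
walk without repeated vertices, whence the bound on its length that [dist]
requires. *)
Lemma dist_potential (d : G -> G -> nat) :
  (forall u, d u u = 0) ->
  (forall u w v, edge u w -> d u v <= (d w v).+1) ->
  (forall u v, u != v -> exists2 w, edge u w & d u v = (d w v).+1) ->
  forall u v, dist u v = Some (d u v).
Proof.
move=> d0 d_lip d_step u v.
have [t [sz_t pt lt _ ut]] : exists t, [/\ size t = d u v, path edge u t,
    last u t = v, all (fun w => d w v <= d u v) (u :: t) & uniq (u :: t)].
  elim: {u}(d u v) {-2}u (erefl (d u v)) => [|n IHn] u def_d.
    case: (eqVneq u v) => [->|/d_step[w _]]; last by rewrite def_d.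
    by exists [::]; rewrite /= d0.
  have [u_v|/d_step[w uw]] := eqVneq u v.
    by rewrite -u_v d0 in def_d.
  rewrite def_d => -[def_n]; have [t [sz_t pt lt le_t ut]] := IHn w (esym def_n).
  exists (w :: t); rewrite /= uw pt lt; split=> //.
  - by rewrite sz_t def_n.
  - rewrite def_d leqnn def_n leqnSn /=; case/andP: le_t => _ /allP le_t.
    by apply/allP=> z /le_t /leqW.
  rewrite -[(w \notin t) && uniq t]/(uniq (w :: t)) ut andbT.
  by apply/negP=> /(allP le_t); rewrite def_d def_n ltnn.
apply: distI.
- by rewrite -sz_t (leq_trans _ (max_card (mem (u :: t)))) // (card_uniqP ut).
- by apply/walkP; exists t.
move=> m; elim: m u {t sz_t pt lt ut} => [|m IHm] u.
  by move/walk0->; rewrite d0.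
by case/walkS=> w uw /IHm le_m; apply: leq_trans (d_lip _ _ _ uw) _.
Qed.

End Walks.

(** * Words and Hamming distance *)

Section Hamming.
Variable K : finType.
Implicit Types (u v w : {ffun K -> bool}) (k l : K).

Definition ham u v := #|[set k | u k != v k]|.

Definition flip k u : {ffun K -> bool} := [ffun l => u l (+) (l == k)].

Lemma flipE k u l : flip k u l = u l (+) (l == k).
Proof. by rewrite ffunE. Qed.

Lemma flip_neq k l u : l != k -> flip k u l = u l.
Proof. by rewrite flipE => /negPf->; rewrite addbF. Qed.

Lemma flip_eq k u : flip k u k = ~~ u k.
Proof. by rewrite flipE eqxx addbT. Qed.

Lemma flipK k : involutive (flip k).
Proof. by move=> u; apply/ffunP=> l; rewrite !flipE addbK. Qed.

Lemma hamC u v : ham u v = ham v u.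
Proof. by apply: eq_card => k; rewrite !inE eq_sym. Qed.

Lemma ham_eq0 u v : (ham u v == 0) = (u == v).
Proof.
rewrite cards_eq0; apply/eqP/eqP => [/setP uv|->].
  by apply/ffunP=> k; apply/eqP; have:= uv k; rewrite !inE => /negbFE.
by apply/setP=> k; rewrite !inE eqxx.
Qed.

Lemma hamxx u : ham u u = 0.
Proof. by apply/eqP; rewrite ham_eq0. Qed.

Lemma ham_flip k u v : u k != v k -> ham u v = (ham (flip k u) v).+1.
Proof.
move=> uk; rewrite /ham (cardsD1 k) inE uk; congr _.+1; apply: eq_card => l.
rewrite !inE; have [->|lk] := eqVneq l k; last by rewrite flip_neq.
by rewrite flip_eq; case: (u k) uk; case: (v k).
Qed.

Lemma ham_flip_eq k u v : u k = v k -> ham (flip k u) v = (ham u v).+1.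
Proof.
by move=> uk; rewrite (@ham_flip k) ?flipK // flip_eq uk; case: (v k).
Qed.

Lemma ham_lip k u v : ham u v <= (ham (flip k u) v).+1.
Proof.
have [uk|uk] := eqVneq (u k) (v k); last by rewrite -ham_flip.
by rewrite ham_flip_eq // leqW.
Qed.

Lemma ham1P u v : reflect (exists k, v = flip k u) (ham u v == 1).
Proof.
apply: (iffP idP) => [/cards1P[k /setP uv]|[k ->]]; last first.
  by rewrite hamC ham_flip_eq // hamxx.
exists k; apply/ffunP=> l; have:= uv l; rewrite !inE flipE => <-.
by case: (u l); case: (v l).
Qed.

Definition between u v w := forall k, w k = u k \/ w k = v k.

End Hamming.

Lemma between_flip (K : finType) k (u v : {ffun K -> bool}) :
  u k != v k -> between u v (flip k u).
Proof.
move=> uk l; rewrite flipE; have [->|_] := eqVneq l k; last by left; rewrite addbF.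
by right; case: (u k) uk; case: (v k).
Qed.

(** * Isometric embeddings into hypercubes *)

Section Cubical.
Variable K : finType.

(** [K] is an arbitrary finite type, so that products of paths and edges can be
encoded with structured coordinates. *)
Definition cubical (G : sgraph) (phi : G -> {ffun K -> bool}) :=
  forall u v : G, dist u v = Some (ham (phi u) (phi v)).

Section Embedding.
Variables (G : sgraph) (phi : G -> {ffun K -> bool}).

Lemma cubicalI :
  injective phi ->
  (forall u v, edge u v -> exists k, phi v = flip k (phi u)) ->
  (forall u v : G, u != v ->
     exists (w : G) k, [/\ edge u w, phi w = flip k (phi u) & phi u k != phi v k]) ->
  cubical phi.
Proof.
move=> phi_inj phi_edge phi_step.
apply: (@dist_potential G (fun u v => ham (phi u) (phi v))) => [u|u w v|u v].
- exact: hamxx.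
- by case/phi_edge=> k ->; apply: ham_lip.
by case/phi_step=> w [k [uw def_w /ham_flip eq_d]]; exists w; rewrite ?def_w.
Qed.

Hypothesis phi_cub : cubical phi.

Lemma cubical_inj : injective phi.
Proof.
move=> u v uv; have := phi_cub u v; rewrite uv hamxx => /distP[w _].
exact: walk0 w.
Qed.

Lemma cubical_edge (u v : G) : edge u v = (ham (phi u) (phi v) == 1).
Proof.
have [wd min_d] := distP (phi_cub u v); apply/idP/eqP => [uv|d1].
  apply/eqP; rewrite eqn_leq min_d ?walk1 // lt0n ham_eq0.
  by apply: contraTneq uv => /cubical_inj->; rewrite edge_irr.
by rewrite -walk1 -d1.
Qed.

Lemma cubical_edgeP (u v : G) :
  reflect (exists k, phi v = flip k (phi u)) (edge u v).
Proof. by rewrite cubical_edge; apply: ham1P. Qed.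

(** The form in which isometry is used: a geodesic starts by correcting a
coordinate. *)
Lemma cubical_step (u v : G) : u != v ->
  exists (w : G) k, [/\ edge u w, phi w = flip k (phi u) & phi u k != phi v k].
Proof.
move=> u_v; have [wd _] := distP (phi_cub u v).
case def_d: (ham (phi u) (phi v)) wd => [|d].
  by move/walk0/eqP; rewrite (negPf u_v).
case/walkS=> w uw /(distP (phi_cub w v)).2 le_d.
have [k def_w] := cubical_edgeP _ _ uw; exists w, k; split=> //.
apply: contraTneq le_d => /ham_flip_eq; rewrite -def_w def_d => ->.
by rewrite -ltnNge ltnW.
Qed.

Lemma cubical_distn (u v : G) : distn u v = ham (phi u) (phi v).
Proof. by rewrite /distn phi_cub. Qed.

Lemma cubical_connect (u v : G) : connect edge u v.
Proof. by have [/walk_connect] := distP (phi_cub u v). Qed.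

End Embedding.
End Cubical.

(** * Daisy cubes as star-shaped sets of words *)

Section Daisy.

Lemma hypercube_cubical n : cubical (fun u : hypercube n => u).
Proof.
apply: cubicalI => [u v //|u v uv|u v].
  exact/ham1P.
have [k uk uv|uv] := pickP (fun k => u k != v k); last first.
  by case/eqP; apply/ffunP => k; apply/eqP/negbFE/uv.
by exists (flip k u), k; split=> //; apply/ham1P; exists k.
Qed.

Lemma partial_cubeI (K : finType) (G : sgraph) (phi : G -> {ffun K -> bool}) :
  0 < #|G| -> cubical phi -> is_partial_cube G.
Proof.
move=> G_gt0 phi_cub; split; first by split=> // u v; apply: (cubical_connect phi_cub).
pose f (u : G) : hypercube #|K| := [ffun i => phi u (enum_val i)].
have f_ham u v : ham (f u) (f v) = ham (phi u) (phi v).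
  rewrite /ham -(card_imset _ (@enum_val_inj _ _)); apply: eq_card => k.
  rewrite !inE; apply/imsetP/idP => [[i]|uk]; first by rewrite inE !ffunE => ? ->.
  by exists (enum_rank k); rewrite ?inE ?ffunE enum_rankK.
exists #|K|, f; split=> [u v fuv|u v|u v].
- by apply: (cubical_inj phi_cub); apply/eqP; rewrite -ham_eq0 -f_ham fuv hamxx.
- rewrite (cubical_edge phi_cub) -f_ham => /eqP uv; exact/eqP.
by rewrite phi_cub -f_ham hypercube_cubical.
Qed.

(** Translating the word [c] to [0] turns a set of words that is star-shaped
about [c] into a down-set. *)
Lemma daisy_of_star (K : finType) (G : sgraph) (phi : G -> {ffun K -> bool}) c :
  0 < #|G| -> injective phi ->
  (forall u v, edge u v = (ham (phi u) (phi v) == 1)) ->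
  (forall u w, between (phi u) c w -> exists u', phi u' = w) ->
  is_daisy_cube G.
Proof.
move=> /card_gt0P[u0 _] phi_inj phi_edge star.
pose f (u : G) : hypercube #|K| :=
  [ffun i => phi u (enum_val i) (+) c (enum_val i)].
have fE u k : f u (enum_rank k) = phi u k (+) c k by rewrite ffunE enum_rankK.
have f_ham u v : ham (f u) (f v) = ham (phi u) (phi v).
  rewrite /ham -(card_imset _ (@enum_val_inj _ _)); apply: eq_card => k.
  rewrite !inE; apply/imsetP/idP => [[i]|uk].
    by rewrite inE !ffunE => neq ->; apply: contraNneq neq => ->.
  exists (enum_rank k); rewrite ?inE ?fE ?enum_rankK //.
  by apply: contraNneq uk => /addIb->.
have f_in u : f u \in [set f u | u : G] by apply: imset_f.
exists #|K|, [set f u | u : G]; split.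
- by apply/set0Pn; exists (f u0).
- move=> u _ /imsetP[v _ ->] le_uv.
  have [|u' def_u'] := star v [ffun k => u (enum_rank k) (+) c k].
    move=> k; have:= le_uv (enum_rank k); rewrite fE ffunE.
    by case: (u _); case: (c k); case: (phi v k) => //= _; auto.
  apply/imsetP; exists u' => //; apply/ffunP=> i.
  by rewrite -[i]enum_valK fE def_u' ffunE addbK.
have f_inj : injective f.
  by move=> u v fuv; apply/phi_inj/eqP; rewrite -ham_eq0 -f_ham fuv hamxx.
exists (fun u => exist _ (f u) (f_in u)); split; last first.
  by move=> u v; rewrite phi_edge -f_ham.
apply: inj_card_bij => [u v [/f_inj]//|].
by rewrite card_sig (eq_card (_ : _ =i [set f u | u : G])) // card_imset.
Qed.

(** A down-set is isometric: clearing in the first word the letters [true] that the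
second one lacks, and then setting the missing ones, stays inside it. *)
Lemma star_of_daisy (G : sgraph) : is_daisy_cube G ->
  exists n (phi : G -> {ffun 'I_n -> bool}) c, cubical phi /\
    forall u w, between (phi u) (phi c) w -> exists u', phi u' = w.
Proof.
case=> n [D [/set0Pn[d0 d0D] downD [f [[g gK fK] f_edge]]]].
pose phi u : {ffun 'I_n -> bool} := val (f u).
have phi_surj d : d \in D -> exists u, phi u = d.
  by move=> dD; exists (g (exist _ d dD)); rewrite /phi fK.
have phiD u : phi u \in D := valP (f u).
have [c phi_c] : exists c, phi c = [ffun=> false].
  by apply: phi_surj; apply: downD d0D _ => i; rewrite ffunE.
have phi_inj : injective phi by move=> u v /val_inj/(can_inj gK).
have phi_edge u v : edge u v = (ham (phi u) (phi v) == 1) by rewrite -f_edge.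
exists n, phi, c; split; last first.
  move=> u w uw; apply: phi_surj; apply: downD (phiD u) _ => i.
  by have [->|->] := uw i; rewrite ?phi_c ?ffunE.
apply: cubicalI => // [u v|u v u_v]; first by rewrite phi_edge => /ham1P.
have phi_uv : phi u != phi v by rewrite inj_eq.
suff [k [uk /phi_surj[w def_w]]] :
    exists k, phi u k != phi v k /\ flip k (phi u) \in D.
  by exists w, k; split=> //; rewrite phi_edge; apply/ham1P; exists k.
have [k'|le_uv] := pickP (fun k => phi u k && ~~ phi v k).
  case/andP=> uk vk; exists k'; rewrite uk (negPf vk); split=> //.
  apply: downD (phiD u) _ => l; rewrite flipE; have [->|_] := eqVneq l k'.
    by rewrite uk.
  by rewrite addbF.
have [k uk|eq_uv] := pickP (fun k => phi u k != phi v k); last first.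
  by case/eqP: phi_uv; apply/ffunP => k; apply/eqP/negbFE/eq_uv.
exists k; split=> //; apply: downD (phiD v) _ => l; rewrite flipE.
have [->|_] := eqVneq l k; first by case: (phi u k) uk; case: (phi v k).
by rewrite addbF; have:= le_uv l; case: (phi u l); case: (phi v l).
Qed.

End Daisy.

(** * An obstruction to being a daisy cube *)

Section Intrinsic.
Variables (G : sgraph) (K L : finType).
Variables (phi : G -> {ffun K -> bool}) (psi : G -> {ffun L -> bool}).
Hypotheses (phi_cub : cubical phi) (psi_cub : cubical psi).

(** Both embeddings have distance-many coordinates in which [z] and [c] differ.
If all the flips towards [psi c] are available for [psi], then [z] has that many
neighbours closer to [c], and these use up all the flips towards [phi c]. *)
Lemma star_flip c :
  (forall u w, between (psi u) (psi c) w -> exists u', psi u' = w) ->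
  forall z l, phi z l != phi c l -> exists w, phi w = flip l (phi z).
Proof.
move=> star z l zl.
have ham_eq u : ham (psi u) (psi c) = ham (phi u) (phi c).
  by have := psi_cub u c; rewrite phi_cub => -[].
pose X := [set w | edge z w && (ham (phi w) (phi c) < ham (phi z) (phi c))].
pose F w := [set m | phi z m != phi w m].
have F_flip w m : phi w = flip m (phi z) -> F w = [set m].
  move=> def_w; apply/setP=> n; rewrite !inE def_w flipE.
  by case: (phi z n); case: (n == m).
have le_X : ham (phi z) (phi c) <= #|X|.
  pose F' w := [set k | psi z k != psi w k].
  rewrite -ham_eq /ham -(card_imset _ (@set1_inj L)).
  apply: leq_trans (leq_imset_card F' X); apply/subset_leq_card/subsetP=> A.
  case/imsetP=> k; rewrite inE => zk ->.
  have [w def_w] := star _ _ (between_flip zk).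
  apply/imsetP; exists w.
    rewrite inE -!ham_eq def_w -(ham_flip zk) leqnn andbT.
    by apply/(cubical_edgeP psi_cub); exists k.
  apply/setP=> n; rewrite !inE def_w flipE.
  by case: (psi z n); case: (n == k).
have sub_X : F @: X \subset [set [set m] | m in [set k | phi z k != phi c k]].
  apply/subsetP=> A /imsetP[w]; rewrite inE => /andP[zw lt_w] ->.
  have [m def_w] := cubical_edgeP phi_cub _ _ zw.
  rewrite (F_flip _ _ def_w); apply: imset_f; rewrite inE.
  by apply: contraTneq lt_w => /ham_flip_eq; rewrite def_w -leqNgt => ->.
have F_inj : {in X &, injective F}.
  move=> w w' _ _ /setP eqF; apply: (cubical_inj phi_cub); apply/ffunP=> m.
  have := eqF m; rewrite !inE.
  by case: (phi z m); case: (phi w m); case: (phi w' m).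
have /eqP eq_X : F @: X == [set [set m] | m in [set k | phi z k != phi c k]].
  by rewrite eqEcard sub_X (card_in_imset F_inj) (card_imset _ (@set1_inj K)).
have: [set l] \in F @: X by rewrite eq_X imset_f ?inE.
case/imsetP=> w wX eqF; exists w; move: wX; rewrite inE => /andP[zw _].
have [m def_w] := cubical_edgeP phi_cub _ _ zw.
by rewrite def_w; move: eqF; rewrite (F_flip _ _ def_w) => /set1_inj->.
Qed.

End Intrinsic.

(** In a daisy cube each class of parallel edges has a side all of whose vertices
are incident with the class, namely the side away from the centre. *)
Lemma not_daisy (G : sgraph) (K : finType) (phi : G -> {ffun K -> bool}) l a b :
  cubical phi -> phi a l != phi b l ->
  (forall w, phi w != flip l (phi a)) -> (forall w, phi w != flip l (phi b)) ->
  ~ is_daisy_cube G.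
Proof.
move=> phi_cub ab_l no_a no_b /star_of_daisy[n [psi [c [psi_cub star]]]].
have flip_c := star_flip phi_cub psi_cub star.
have [ac|/flip_c[w]] := eqVneq (phi a l) (phi c l); last by move/eqP; rewrite (negPf (no_a w)).
have [bc|/flip_c[w]] := eqVneq (phi b l) (phi c l); last by move/eqP; rewrite (negPf (no_b w)).
by rewrite ac bc eqxx in ab_l.
Qed.

(** * Restrictions and contractions in coordinates *)

Section Minors.
Variables (G : sgraph) (K : finType) (phi : G -> {ffun K -> bool}).
Hypothesis phi_cub : cubical phi.
Variables (k : K) (a b : G).
Hypothesis def_b : phi b = flip k (phi a).

(** The edge [ab] differs in [k] only, so the distances of [u] to its ends differ
by one, and the end that agrees with [u] at [k] is the closer one. *)
Lemma ham_edge u :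
  ham (phi a) (phi u) + (phi u k == phi a k) =
  ham (phi b) (phi u) + (phi u k != phi a k).
Proof.
rewrite def_b eq_sym; case: eqVneq => [/ham_flip_eq->|/ham_flip->].
  by rewrite addn0 addn1.
by rewrite addn1 addn0.
Qed.

Lemma theta_coord u v : theta a b u v = (phi u k != phi v k).
Proof.
have:= ham_edge u; have:= ham_edge v.
rewrite /theta !(cubical_distn phi_cub).
by case: (phi u k) (phi v k) (phi a k) => [] [] [] /=; lia.
Qed.

Lemma in_halfspace z : (z \in halfspace a b) = (phi z k == phi a k).
Proof.
rewrite inE !(cubical_distn phi_cub).
by have:= ham_edge z; case: (_ == _) => /=; lia.
Qed.

Lemma restriction_proper : ~ isomorphic (restriction a b) G.
Proof.
case=> f [f_bij _]; have := bij_eq_card f_bij; rewrite card_sig => eqG.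
have : halfspace a b != setT.
  apply: contraTneq (in_setT b) => <-; rewrite in_halfspace def_b flip_eq.
  by case: (phi a k).
case/eqP; apply/eqP; rewrite eqEcard subsetT cardsT /= -eqG.
by rewrite leq_eqVlt; apply/orP; left; apply/eqP/eq_card.
Qed.

(** A geodesic corrects only coordinates in which its ends differ, hence stays
inside the halfspace that contains them. *)
Lemma cubical_restriction :
  cubical (fun z : restriction a b => phi (val z)).
Proof.
apply: cubicalI => [u v /(cubical_inj phi_cub)/val_inj //|u v|u v u_v].
  by move/(cubical_edgeP phi_cub).
have [|w [l [uw def_w uv_l]]] := cubical_step phi_cub (u := val u) (v := val v).
  by rewrite (inj_eq val_inj).
have wH : w \in halfspace a b.
  have /eqP ua : phi (val u) k == phi a k by rewrite -in_halfspace (valP u).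
  have /eqP va : phi (val v) k == phi a k by rewrite -in_halfspace (valP v).
  by rewrite in_halfspace def_w flip_neq ?ua //; apply: contraNneq uv_l => <-; rewrite ua va.
by exists (exist _ w wH), l.
Qed.

Lemma restriction_daisy (c : {ffun K -> bool}) :
  (forall u w, phi u k = phi a k -> between (phi u) c w ->
     exists2 u', phi u' k = phi a k & phi u' = w) ->
  is_daisy_cube (restriction a b).
Proof.
have aH : a \in halfspace a b by rewrite in_halfspace.
move=> star; apply: (daisy_of_star (phi := fun z : restriction a b => phi (val z))
  (c := c)).
- by apply/card_gt0P; exists (exist _ a aH).
- exact: cubical_inj cubical_restriction.
- exact: cubical_edge cubical_restriction.
move=> u w uw; have [|u' u'k def_u'] := star (val u) w _ uw.
  by apply/eqP; rewrite -in_halfspace; apply: valP.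
have u'H : u' \in halfspace a b by rewrite in_halfspace u'k.
by exists (exist _ u' u'H).
Qed.

(** This turns out to be connectedness along the Theta-class of [ab]: the classes
are the ends of an edge of the Theta-class, or single vertices. *)
Definition parallel : rel G :=
  fun u v => [forall l, (l != k) ==> (phi u l == phi v l)].

Lemma parallelP u v :
  reflect (forall l, l != k -> phi u l = phi v l) (parallel u v).
Proof. by apply: (iffP 'forall_implyP) => uv l /uv/eqP. Qed.

Lemma parallel_equiv : {in setT & &, equivalence_rel parallel}.
Proof.
move=> u v w _ _ _; split; first exact/parallelP.
move=> /parallelP uv; apply/parallelP/parallelP => H l lk.
  by rewrite -uv ?H.
by rewrite uv ?H.
Qed.

Lemma parallel_cases u v : parallel u v -> u = v \/ phi v = flip k (phi u).
Proof.
move=> /parallelP uv; have [uv_k|uv_k] := eqVneq (phi u k) (phi v k).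
  left; apply: (cubical_inj phi_cub); apply/ffunP=> l.
  by have [->//|/uv] := eqVneq l k.
right; apply/ffunP=> l; have [->|lk] := eqVneq l k; last by rewrite flip_neq ?uv.
by rewrite flip_eq; case: (phi u k) uv_k; case: (phi v k).
Qed.

Lemma connect_theta u v : connect (theta_class a b) u v = parallel u v.
Proof.
apply/idP/idP => [|/parallel_cases[->|def_v]].
- case/connectP=> t pt ->; elim: t u pt => [|w t IHt] u /=.
    by move=> _; apply/parallelP.
  case/andP=> /andP[uw]; rewrite theta_coord => uw_k /IHt /parallelP wv.
  have [l def_w] := cubical_edgeP phi_cub _ _ uw.
  have l_k: l = k.
    by apply: contraNeq uw_k => lk; rewrite def_w flip_neq // eq_sym.
  by apply/parallelP=> m mk; rewrite -wv // def_w l_k flip_neq.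
- exact: connect0.
apply: connect1; rewrite /theta_class theta_coord def_v flip_eq.
by rewrite (introT (cubical_edgeP phi_cub _ _)) ?addbN; [case: (phi u k) | exists k].
Qed.

Lemma contraction_blocksE :
  contraction_blocks a b = equivalence_partition parallel [set: G].
Proof.
rewrite /contraction_blocks /equivalence_partition; apply: eq_imset => u.
by apply/setP=> v; rewrite !inE connect_theta.
Qed.

Notation M := (contraction a b).

Lemma block_of u : exists A : M, u \in val A.
Proof.
have /and3P[/eqP covG _ _] := equivalence_partitionP parallel_equiv.
have : u \in cover (contraction_blocks a b).
  by rewrite contraction_blocksE covG inE.
by case/bigcupP=> A AB uA; exists (exist _ A AB).
Qed.

Lemma block_partition (A : M) :
  val A \in equivalence_partition parallel [set: G].
Proof. by rewrite -contraction_blocksE; apply: valP A. Qed.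

Lemma block_nonempty (A : M) : exists u, u \in val A.
Proof.
have /and3P[_ _ B0] := equivalence_partitionP parallel_equiv.
by apply/set0Pn; apply: contraTneq (block_partition A) => ->.
Qed.

Lemma in_block (A : M) u v : u \in val A -> (v \in val A) = parallel u v.
Proof.
move=> uA.
have /and3P[_ tI _] := equivalence_partitionP parallel_equiv.
rewrite -(def_pblock tI (block_partition A) uA).
by rewrite (pblock_equivalence_partition parallel_equiv) ?inE.
Qed.

(** Overwriting the letter at [k], rather than deleting it, keeps the set of
coordinates. *)
Definition block_word (A : M) : {ffun K -> bool} :=
  [ffun l => phi (xchoose (block_nonempty A)) l && (l != k)].

Lemma block_wordE (A : M) u l : u \in val A -> block_word A l = phi u l && (l != k).
Proof.
move=> uA; rewrite ffunE; have [->|lk] := eqVneq l k; first by rewrite !andbF.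
rewrite !andbT; have := xchooseP (block_nonempty A); rewrite (in_block _ uA).
by move/parallelP->.
Qed.

Lemma block_eq (A B : M) u : u \in val A -> u \in val B -> A = B.
Proof.
by move=> uA uB; apply/val_inj/setP=> v; rewrite (in_block _ uA) (in_block _ uB).
Qed.

Lemma block_word_inj : injective block_word.
Proof.
move=> A B /ffunP eqAB.
have [[u uA] [v vB]] := (block_nonempty A, block_nonempty B).
apply: (block_eq (u := v)) => //; rewrite (in_block _ uA); apply/parallelP=> l lk.
by have := eqAB l; rewrite (block_wordE _ uA) (block_wordE _ vB) lk !andbT.
Qed.

(** Words at distance one outside [k] come from adjacent blocks: representatives
differing in [k] as well are at distance two, and a vertex between them lies in
one of the two blocks. *)
Lemma contraction_edgeE (A B : M) :
  edge A B = (ham (block_word A) (block_word B) == 1).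
Proof.
apply/andP/ham1P => [[A_B /exists_inP[u uA /exists_inP[v vB uv]]]|[l def_B]].
  have [l def_v] := cubical_edgeP phi_cub _ _ uv.
  have lk : l != k.
    apply: contraNneq A_B => lk; apply/eqP/(block_eq (u := v)) => //.
    rewrite (in_block _ uA); apply/parallelP=> m mk.
    by rewrite def_v lk flip_neq.
  exists l; apply/ffunP=> m.
  rewrite flipE (block_wordE _ vB) (block_wordE _ uA) def_v flipE.
  by have [->|] := eqVneq m l; rewrite ?lk ?andbT ?addbF.
have A_B : A != B.
  by apply: contra_eqN def_B => /eqP->; apply/eqP=> /ffunP/(_ l);
     rewrite flip_eq; case: (block_word B l).
split=> //.
have [[u uA] [v vB]] := (block_nonempty A, block_nonempty B).
have lk : l != k.
  apply: contraNneq A_B => lk; apply/eqP/block_word_inj/ffunP=> m.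
  rewrite def_B lk flipE; have [->|] := eqVneq m k; last by rewrite addbF.
  by have /ffunP/(_ k) := def_B; rewrite lk flip_eq !ffunE eqxx !andbF.
have uv m : m != k -> phi v m = flip l (phi u) m.
  move=> mk; have /ffunP/(_ m) := def_B; rewrite !flipE.
  by rewrite (block_wordE _ vB) (block_wordE _ uA) mk !andbT.
have u_v : u != v.
  apply: contraNneq A_B => u_v; apply/eqP/(block_eq (u := u)) => //.
  by rewrite u_v.
have [w [m [uw def_w uv_m]]] := cubical_step phi_cub u_v.
have [mk|mk] := eqVneq m k.
  have wA : w \in val A.
    by rewrite (in_block _ uA); apply/parallelP=> n nk; rewrite def_w mk flip_neq.
  apply/exists_inP; exists w => //; apply/exists_inP; exists v => //.
  apply/(cubical_edgeP phi_cub); exists l; apply/ffunP=> n.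
  have [->|nk] := eqVneq n k.
    rewrite flip_neq 1?eq_sym // def_w mk flip_eq.
    by move: uv_m; rewrite mk; case: (phi u k); case: (phi v k).
  by rewrite uv // !flipE def_w mk flip_neq.
have ml : m = l.
  by apply: contraNeq uv_m => ml; rewrite uv // flip_neq.
have wB : w \in val B.
  rewrite (in_block _ vB); apply/parallelP=> n nk.
  by rewrite uv // def_w ml.
apply/exists_inP; exists u => //; apply/exists_inP; exists w => //.
Qed.

(** It suffices that the words of [G] are star-shaped up to their letter at [k],
because the contraction does not see this letter. *)
Lemma contraction_daisy (c : {ffun K -> bool}) :
  (forall u w, between (phi u) c w -> exists u', forall l, l != k -> phi u' l = w l) ->
  is_daisy_cube M.
Proof.
move=> star; apply: (daisy_of_star (phi := block_word)
  (c := [ffun l => c l && (l != k)])).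
- by have [A _] := block_of a; apply/card_gt0P; exists A.
- exact: block_word_inj.
- exact: contraction_edgeE.
move=> A w Aw; have [u uA] := block_nonempty A.
have [|u' def_u'] := star u [ffun l => if l == k then c l else w l].
  move=> l; rewrite ffunE; have [_|lk] := eqVneq l k; first by right.
  by have := Aw l; rewrite (block_wordE _ uA) ffunE lk !andbT.
have [A' u'A'] := block_of u'; exists A'; apply/ffunP=> l.
rewrite (block_wordE _ u'A'); have [->|lk] := eqVneq l k.
  by have := Aw k; rewrite !ffunE eqxx !andbF => -[] ->.
by rewrite def_u' // ffunE (negPf lk) andbT.
Qed.

End Minors.

(** A star-shaped set meets a halfspace in a set that is star-shaped about the
centre moved into this halfspace. *)
Lemma restriction_closed (G : sgraph) (a b : G) :
  is_daisy_cube G -> edge a b -> is_daisy_cube (restriction a b).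
Proof.
case/star_of_daisy=> n [phi [c [phi_cub star]]] /(cubical_edgeP phi_cub)[k def_b].
apply: (restriction_daisy phi_cub def_b
  (c := [ffun l => if l == k then phi a k else phi c l])) => u w ua uw.
have [|u' def_u'] := star u w.
  move=> l; have := uw l; rewrite ffunE.
  by have [->|] := eqVneq l k => // -[] ->; left.
exists u' => //; rewrite def_u'.
by have := uw k; rewrite ffunE eqxx ua => -[].
Qed.

Lemma contraction_closed (G : sgraph) (a b : G) :
  is_daisy_cube G -> edge a b -> is_daisy_cube (contraction a b).
Proof.
case/star_of_daisy=> n [phi [c [phi_cub star]]] /(cubical_edgeP phi_cub)[k def_b].
apply: (contraction_daisy phi_cub def_b (c := phi c)) => u w /star[u' def_u'].
by exists u' => l _; rewrite def_u'.
Qed.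

Lemma isomorphic_refl (G : sgraph) : isomorphic G G.
Proof. by exists id; split=> //; exists id. Qed.

(** Daisy cubes are closed under pc-minors, so only the minors reached in one step
need to be examined. *)
Lemma minimal_forbiddenI (G : sgraph) :
  is_partial_cube G -> ~ is_daisy_cube G ->
  (forall a b : G, edge a b -> is_daisy_cube (restriction a b)) ->
  (forall a b : G, edge a b -> is_daisy_cube (contraction a b)) ->
  minimal_forbidden_pc_minor G.
Proof.
move=> G_pc G_nd G_res G_con; split=> // M GM not_iso.
suff [M_G|//] : M = G \/ is_daisy_cube M.
  by case: not_iso; rewrite M_G; apply: isomorphic_refl.
elim: {M not_iso} GM => [|M a b _ IH ab|M a b _ IH ab]; first by left.
  right; case: IH => [M_G|M_d]; last exact: restriction_closed.
  by move: a b ab; rewrite M_G.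
right; case: IH => [M_G|M_d]; last exact: contraction_closed.
by move: a b ab; rewrite M_G.
Qed.

(** The obstruction of [not_daisy] is inherited by any proper restriction that
still contains the two vertices causing it. *)
Lemma not_minimal (G : sgraph) (K : finType) (phi : G -> {ffun K -> bool})
    k a b l a' b' :
  cubical phi -> phi b = flip k (phi a) ->
  phi a' k = phi a k -> phi b' k = phi a k -> phi a' l != phi b' l ->
  (forall w, phi w != flip l (phi a')) -> (forall w, phi w != flip l (phi b')) ->
  ~ minimal_forbidden_pc_minor G.
Proof.
move=> phi_cub def_b a'k b'k ab_l no_a no_b [_ _ /(_ (restriction a b)) min_G].
have ab : edge a b by apply/(cubical_edgeP phi_cub); exists k.
have a'H : a' \in halfspace a b by rewrite (in_halfspace phi_cub def_b) a'k.
have b'H : b' \in halfspace a b by rewrite (in_halfspace phi_cub def_b) b'k.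
pose a1 : restriction a b := exist _ a' a'H.
pose b1 : restriction a b := exist _ b' b'H.
apply: (not_daisy (a := a1) (b := b1) (cubical_restriction phi_cub def_b) ab_l)
  => [w|w|]; [exact: no_a | exact: no_b | apply: min_G].
  exact: pc_minor_restriction (pc_minor_refl G) ab.
exact (restriction_proper phi_cub def_b).
Qed.
(** * The coding of products of three-vertex paths and edges *)
Definition mid : 'I_3 := @Ordinal 3 1 isT.

Definition tip (b : bool) : 'I_3 := if b then ord_max else ord0.

Lemma tipP (t : 'I_3) : t = mid \/ exists b, t = tip b.
Proof.
case: t => [[|[|[|//]]] lt3].
- by right; exists false; apply: val_inj.
- by left; apply: val_inj.
- by right; exists true; apply: val_inj.
Qed.

Lemma tip_inj : injective tip.
Proof. by case; case. Qed.

Lemma tip_mid b : (tip b == mid) = false.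
Proof. by case: b. Qed.

Section Coding.
Variables r s : nat.
Implicit Types (u v w x y z : B r s) (i : 'I_r) (j : 'I_s).

Notation index := (('I_r * bool) + 'I_s)%type.

(** A ternary coordinate yields one letter for each tip of the path: the
Theta-classes of the path are its two edges, and the edge at a tip separates
this tip from the rest. *)
Definition code u : {ffun index -> bool} :=
  [ffun k => match k with inl (i, b) => u.1 i == tip b | inr j => u.2 j end].

Lemma codeP3 u i b : code u (inl (i, b)) = (u.1 i == tip b).
Proof. by rewrite ffunE. Qed.

Lemma codebit u j : code u (inr j) = u.2 j.
Proof. by rewrite ffunE. Qed.

(** The words that are not codes are those that claim both tips at once. *)
Lemma code_excl u i b : code u (inl (i, b)) -> code u (inl (i, ~~ b)) = false.
Proof. by rewrite !codeP3 => /eqP->; case: b. Qed.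

Lemma B_ext u v : (forall i, u.1 i = v.1 i) -> (forall j, u.2 j = v.2 j) -> u = v.
Proof.
case: u v => [u1 u2] [v1 v2] /= e1 e2.
by congr (_, _); apply/ffunP.
Qed.

Lemma tip_ext (t t' : 'I_3) : (forall b, (t == tip b) = (t' == tip b)) -> t = t'.
Proof.
case: (tipP t) (tipP t') => [->|[b ->]] [->|[b' ->]] st //.
- by have := st b'; rewrite [RHS]eqxx eq_sym tip_mid.
- by have := st b; rewrite [LHS]eqxx [RHS]eq_sym tip_mid.
by have := st b; rewrite [LHS]eqxx => /esym/eqP.
Qed.

Lemma code_inj : injective code.
Proof.
move=> u v /ffunP uv; apply: B_ext => [i|j]; last by have := uv (inr j); rewrite !codebit.
by apply: tip_ext => b; rewrite -!codeP3.
Qed.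

Definition set3 u i t : B r s := ([ffun i' => if i' == i then t else u.1 i'], u.2).

Definition flip2 u j : B r s := (u.1, [ffun j' => u.2 j' (+) (j' == j)]).

Lemma set3E u i t i' : (set3 u i t).1 i' = if i' == i then t else u.1 i'.
Proof. by rewrite ffunE. Qed.

Lemma set3_same u i t : (set3 u i t).1 i = t.
Proof. by rewrite set3E eqxx. Qed.

Lemma flip2E u j j' : (flip2 u j).2 j' = u.2 j' (+) (j' == j).
Proof. by rewrite ffunE. Qed.

Lemma flip2K j : involutive (flip2^~ j).
Proof. by move=> u; apply: B_ext => //= j'; rewrite !ffunE addbK. Qed.

Lemma code_flip2 u j : code (flip2 u j) = flip (inr j) (code u).
Proof.
by apply/ffunP=> -[[i b]|j']; rewrite flipE !ffunE ?addbF.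
Qed.

Lemma code_set3 u i b :
  u.1 i = mid -> code (set3 u i (tip b)) = flip (inl (i, b)) (code u).
Proof.
move=> ui; apply/ffunP=> -[[i' b']|j]; rewrite flipE ?codeP3 ?codebit ?addbF //.
rewrite set3E; have [->|ii] := eqVneq i' i; last first.
  by rewrite [_ == _ :> index](_ : _ = false) ?addbF //; apply: contraNF ii => /eqP[->].
rewrite ui [X in X (+) _]eq_sym tip_mid /=.
rewrite [RHS](_ : _ = (b' == b)); last by apply/eqP/eqP => [[]|->].
by case: b; case: b'.
Qed.

Lemma code_set_mid u i b :
  u.1 i = tip b -> code (set3 u i mid) = flip (inl (i, b)) (code u).
Proof.
move=> ui; suff -> : code u = flip (inl (i, b)) (code (set3 u i mid)).
  by rewrite flipK.
rewrite -code_set3 ?set3_same //; congr code; apply: B_ext => // i'.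
by rewrite !set3E; case: eqVneq => [->|].
Qed.

Lemma B_edgeP u v : reflect (exists k, code v = flip k (code u)) (edge u v).
Proof.
apply: (iffP existsP) => [[k /andP[uv_k /forall_inP same]]|[k def_v]].
  case: k uv_k same => [i|j] /= uv_k same.
    have same_i i' : i' != i -> u.1 i' = v.1 i'.
      by move=> ii; apply/val_inj/eqP/(same (inl i')).
    have same_j j : u.2 j = v.2 j.
      by have := same (inr j) isT; rewrite /=; case: (u.2 j); case: (v.2 j).
    have [ui|[b ui]] := tipP (u.1 i).
      have [b vi] : exists b, v.1 i = tip b.
        by have [vi|//] := tipP (v.1 i); rewrite ui vi in uv_k.
      exists (inl (i, b)); rewrite -code_set3 //; congr code; apply: B_ext => // i'.
      by rewrite set3E; case: eqVneq => [->|/same_i].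
    have vi : v.1 i = mid.
      have [//|[b' vi]] := tipP (v.1 i).
      by move: uv_k; rewrite ui vi; case: b {ui}; case: b' {vi}.
    exists (inl (i, b)); rewrite -code_set_mid //; congr code; apply: B_ext => // i'.
    by rewrite set3E; case: eqVneq => [->|/same_i].
  exists (inr j); rewrite -code_flip2; congr code; apply: B_ext => [i|j'].
    by apply/val_inj/esym/eqP/(same (inl i)).
  rewrite flip2E; have [->|jj] := eqVneq j' j.
    by move: uv_k; case: (u.2 j); case: (v.2 j).
  by have := same (inr j'); rewrite /= addbF; case: (u.2 j') (v.2 j') => [] [] // /(_ jj).
case: k def_v => [[i b]|j] def_v; last first.
  have -> : v = flip2 u j by apply: code_inj; rewrite code_flip2.
  exists (inr j); rewrite /= flip2E eqxx; apply/andP; split; first by case: (u.2 j).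
  apply/forall_inP=> -[i|j'] //= jj; rewrite flip2E; have -> : j' == j = false.
    by apply: contraNF jj => /eqP->.
  by rewrite addbF.
have rest t : [forall l, (l != inl i) ==> (coord u l == coord (set3 u i t) l)].
  apply/forall_inP=> -[i'|j] ii; last exact: eqxx.
  by rewrite /= set3E ifN //; apply: contraNN ii => /eqP->.
have [ui|[b' ui]] := tipP (u.1 i).
  have -> : v = set3 u i (tip b) by apply: code_inj; rewrite code_set3.
  by exists (inl i); rewrite rest /= set3_same ui; case: (b).
have b_b' : b' = b.
  apply/eqP; apply: contraT => b_b'.
  have := @code_excl v i b'; have -> : ~~ b' = b by case: b b' b_b' {ui def_v} => [] [].
  rewrite def_v flip_eq flip_neq; last by apply: contraNneq b_b' => -[->].
  by rewrite !codeP3 ui eqxx (inj_eq tip_inj) (negPf b_b') => /(_ isT).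
have -> : v = set3 u i mid by apply: code_inj; rewrite (code_set_mid (b := b)) // -b_b'.
by exists (inl i); rewrite rest /= set3_same ui; case: (b').
Qed.

Lemma set3_edge u i b : u.1 i = mid -> edge u (set3 u i (tip b)).
Proof. by move=> ui; apply/B_edgeP; exists (inl (i, b)); apply: code_set3. Qed.

Lemma set_mid_edge u i b : u.1 i = tip b -> edge u (set3 u i mid).
Proof. by move=> ui; apply/B_edgeP; exists (inl (i, b)); apply: code_set_mid. Qed.

Lemma flip2_edge u j : edge u (flip2 u j).
Proof. by apply/B_edgeP; exists (inr j); apply: code_flip2. Qed.

Lemma B_cubical : cubical code.
Proof.
apply: cubicalI => [|u v /B_edgeP //|u v u_v]; first exact: code_inj.
have [j uv_j|eq2] := pickP (fun j => u.2 j != v.2 j).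
  exists (flip2 u j), (inr j).
  by rewrite !codebit; split=> //; [apply: flip2_edge | apply: code_flip2].
have [i uv_i|eq1] := pickP (fun i => u.1 i != v.1 i); last first.
  by case/eqP: u_v; apply: B_ext => k; apply/eqP/negbFE; [apply: eq1 | apply: eq2].
have [ui|[b ui]] := tipP (u.1 i); last first.
  exists (set3 u i mid), (inl (i, b)); rewrite !codeP3 ui eqxx.
  split; [exact: set_mid_edge ui | exact: code_set_mid |].
  by apply: contra uv_i => /eqP/esym/eqP->; rewrite ui.
have [b vi] : exists b, v.1 i = tip b.
  by have [vi|//] := tipP (v.1 i); rewrite ui vi in uv_i.
exists (set3 u i (tip b)), (inl (i, b)); rewrite !codeP3 ui vi eqxx [mid == _]eq_sym tip_mid.
by split; [apply: set3_edge | apply: code_set3 |].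
Qed.

Definition in_box u v z :=
  (forall i, z.1 i = u.1 i \/ z.1 i = v.1 i) /\
  (forall j, z.2 j = u.2 j \/ z.2 j = v.2 j).

(** A word between two codes fails to be a code only by claiming both tips in a
coordinate where the vertices sit at opposite tips, which the hypothesis
excludes. *)
Lemma between_code u v (w : {ffun index -> bool}) :
  (forall i, v.1 i = mid \/ v.1 i = u.1 i) ->
  between (code u) (code v) w -> exists2 z, code z = w & in_box u v z.
Proof.
move=> v_or uw.
pose z : B r s :=
  ([ffun i => if w (inl (i, false)) then tip false
              else if w (inl (i, true)) then tip true else mid],
   [ffun j => w (inr j)]).
have z1 i : [/\ w (inl (i, false)) = (z.1 i == tip false),
    w (inl (i, true)) = (z.1 i == tip true) & z.1 i = u.1 i \/ z.1 i = v.1 i].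
  rewrite /= ffunE; have := (uw (inl (i, false)), uw (inl (i, true))).
  rewrite !codeP3; case: (v_or i) => [->|->].
    rewrite ![mid == _]eq_sym !tip_mid.
    by have [->|[[] ->]] := tipP (u.1 i) => -[] [] -> [] -> /=; split; auto.
  by have [->|[[] ->]] := tipP (u.1 i) => -[] [] -> [] -> /=; split; auto.
exists z; last by split=> [i|j]; [have [] := z1 i | rewrite /= ffunE -!codebit].
apply/ffunP=> -[[i b]|j]; last by rewrite codebit ffunE.
by rewrite codeP3; have [] := z1 i; case: b.
Qed.

End Coding.

(** * Corners and boundary edges *)

Section Corners.
Variables r s : nat.
Implicit Types (u v x y z : B r s) (i : 'I_r) (j : 'I_s).

Lemma set02P (t : 'I_3) : reflect (exists b, t = tip b) (t \in [set ord0; ord_max]).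
Proof.
rewrite !inE; apply: (iffP orP) => [[/eqP->|/eqP->]|[[] ->]]; rewrite ?eqxx.
- by exists false.
- by exists true.
- by right.
by left.
Qed.

Lemma cornerP x : corner x <-> forall i, x.1 i != mid.
Proof.
split=> [cx i|cx i]; first by have /set02P[b ->] := cx i; rewrite tip_mid.
by apply/set02P; have [xi|] := tipP (x.1 i); first by have := cx i; rewrite xi eqxx.
Qed.

Lemma corner_tip x i : corner x -> exists b, x.1 i = tip b.
Proof. by move/(_ i)/set02P. Qed.

Lemma set02_neq x y i : corner x -> corner y ->
  ([set x.1 i; y.1 i] == [set ord0; ord_max]) = (x.1 i != y.1 i).
Proof.
move=> /(@corner_tip _ i)[b ->] /(@corner_tip _ i)[b' ->].
rewrite (inj_eq tip_inj); case: b b' => [] [] /=.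
- by apply/negbTE/eqP=> /setP/(_ ord0); rewrite !inE.
- by rewrite setUC eqxx.
- by rewrite eqxx.
by apply/negbTE/eqP=> /setP/(_ ord_max); rewrite !inE.
Qed.

Lemma p_diff0P x y : corner x -> corner y ->
  p_diff x y = 0 <-> forall i, x.1 i = y.1 i.
Proof.
move=> cx cy; split=> [/eqP|eq_xy].
  rewrite cards_eq0 => /eqP/setP p0 i; have := p0 i.
  by rewrite !inE set02_neq // => /negbFE/eqP.
by apply/eqP; rewrite cards_eq0; apply/eqP/setP=> i; rewrite !inE set02_neq // eq_xy eqxx.
Qed.

Lemma q_diff0P x y : q_diff x y = 0 <-> forall j, x.2 j = y.2 j.
Proof.
split=> [/eqP|eq_xy].
  rewrite cards_eq0 => /eqP/setP q0 j; have := q0 j.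
  by rewrite !inE => /negbFE/eqP.
by apply/eqP; rewrite cards_eq0; apply/eqP/setP=> i; rewrite !inE eq_xy eqxx.
Qed.

Lemma q_diff1P x y :
  q_diff x y = 1 <-> exists j, forall j', y.2 j' = x.2 j' (+) (j' == j).
Proof.
split=> [/eqP/cards1P[j /setP q1]|[j eq_xy]].
  exists j => j'; have := q1 j'; rewrite !inE => <-.
  by case: (x.2 j'); case: (y.2 j').
apply/eqP/cards1P; exists j; apply/setP=> j'; rewrite !inE eq_xy.
by case: (x.2 j'); case: (j' == j).
Qed.

Lemma p_diff_neq x y : corner x -> corner y -> p_diff x y != r ->
  exists i, x.1 i = y.1 i.
Proof.
move=> cx cy p_r; have [i /eqP|neq_xy] := pickP (fun i => x.1 i == y.1 i).
  by exists i.
case/eqP: p_r; rewrite -[RHS]card_ord -cardsT; apply: eq_card => i.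
by rewrite !inE set02_neq // neq_xy.
Qed.

Lemma q_diff_neq x y : q_diff x y != s -> exists j, x.2 j = y.2 j.
Proof.
move=> q_s; have [j /eqP|neq_xy] := pickP (fun j => x.2 j == y.2 j).
  by exists j.
case/eqP: q_s; rewrite -[RHS]card_ord -cardsT; apply: eq_card => j.
by rewrite !inE neq_xy.
Qed.

Lemma opposite_code x y : opposite_corners x y ->
  forall k, code y k = ~~ code x k.
Proof.
case=> cx cy px qx.
have p_all i : x.1 i != y.1 i.
  have : [set i | [set x.1 i; y.1 i] == [set ord0; ord_max]] == setT.
    by rewrite eqEcard subsetT cardsT card_ord -[X in X <= _]px leqnn.
  by move/eqP/setP/(_ i); rewrite !inE set02_neq.
have q_all j : x.2 j != y.2 j.
  have : [set j | x.2 j != y.2 j] == setT.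
    by rewrite eqEcard subsetT cardsT card_ord -[X in X <= _]qx leqnn.
  by move/eqP/setP/(_ j); rewrite !inE.
case=> [[i b]|j]; last by rewrite !codebit; have := q_all j; case: (x.2 j); case: (y.2 j).
rewrite !codeP3; have := p_all i.
have [b' ->] := corner_tip i cx; have [b'' ->] := corner_tip i cy.
by case: b b' b'' => [] [] [].
Qed.

Lemma opposite_sym x y : opposite_corners x y -> opposite_corners y x.
Proof.
case=> cx cy px qx; split=> //.
  by rewrite -[RHS]px; apply: eq_card => i; rewrite !inE setUC.
by rewrite -[RHS]qx; apply: eq_card => j; rewrite !inE eq_sym.
Qed.

(** A boundary edge oriented towards its corner [y], its direction [i] and the tip
reached there being explicit. *)
Definition P3_edge_at x y i o :=
  [/\ x.1 i = mid, forall i', i' != i -> x.1 i' != mid & y = set3 x i (tip o)].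

Lemma P3_edge_boundary x y i o : P3_edge_at x y i o -> boundary_P3_edge x y.
Proof.
case=> xi x_rest ->; split; first exact: set3_edge.
  by exists i; rewrite set3_same xi eq_sym tip_mid.
right; apply/cornerP=> i'; rewrite set3E.
by have [_|/x_rest//] := eqVneq i' i; rewrite tip_mid.
Qed.

Lemma boundary_sym x y : boundary_P3_edge x y -> boundary_P3_edge y x.
Proof.
case=> xy [i x_y] c; split; first by rewrite edge_sym.
  by exists i; rewrite eq_sym.
by case: c; auto.
Qed.

(** Two corners that differ in a ternary coordinate have codes that differ in two
letters. *)
Lemma boundary_not_corners x y :
  boundary_P3_edge x y -> corner x -> corner y -> False.
Proof.
case=> /B_edgeP[k def_y] [i x_y] _ cx cy.
have /ffunP/(_ (inl (i, true))) := def_y; have /ffunP/(_ (inl (i, false))) := def_y.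
rewrite !flipE !codeP3; move: x_y.
have [b ->] := corner_tip i cx; have [b' ->] := corner_tip i cy.
have inlE b1 i' b2 : (inl (i, b1) == inl (i', b2) :> ('I_r * bool) + 'I_s) =
  (i == i') && (b1 == b2) by [].
case: k {def_y} => [[i' b'']|j]; rewrite ?inlE ?addbF.
  by case: b b' b'' (i == i') => [] [] [] [].
by case: b b' => [] [].
Qed.
End Corners.

(** * Deleting two vertices *)

Section Omits.
Variables r s : nat.
Implicit Types (u v x y z : B r s) (i : 'I_r) (j : 'I_s).

(** The graph is described by any isometric copy in [B r s] instead of as an
induced subgraph: this makes the hypothesis symmetric in [x] and [y], and allows
one graph to be seen as the complement of different pairs of vertices. *)
Definition omits (G : sgraph) (g : G -> B r s) x y :=
  [/\ cubical (fun h => code (g h)), forall h, g h != x, forall h, g h != y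
    & forall z, z != x -> z != y -> exists h, g h = z].

Lemma omits_sym (G : sgraph) (g : G -> B r s) x y : omits g x y -> omits g y x.
Proof. by case=> g_cub gx gy g_im; split=> // z zy zx; apply: g_im. Qed.

Definition center (e : {ffun 'I_s -> bool}) : B r s := ([ffun=> mid], e).

Lemma center1 e i : (center e).1 i = mid.
Proof. by rewrite ffunE. Qed.

(** A vertex that differs from the centre [v] in all coordinates lies on no
interval to [v] but its own, so it can be deleted from a star-shaped set. *)
Lemma box_apex u v z : in_box u v z ->
  (forall i, z.1 i != v.1 i) -> (forall j, z.2 j != v.2 j) -> u = z.
Proof.
case=> box1 box2 z1 z2; apply: B_ext => [i|j].
  by have := z1 i; have [->|->] := box1 i; rewrite ?eqxx.
by have := z2 j; have [->|->] := box2 j; rewrite ?eqxx.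
Qed.

Lemma neq3 u v i : u.1 i != v.1 i -> u != v.
Proof. by apply: contraNneq => ->. Qed.

Lemma neq2 u v j : u.2 j != v.2 j -> u != v.
Proof. by apply: contraNneq => ->. Qed.

Section Fixed.
Variables (G : sgraph) (g : G -> B r s) (x y : B r s).
Hypothesis g_omits : omits g x y.

Let g_cub : cubical (fun h => code (g h)). Proof. by case: g_omits. Qed.
Let gx h : g h != x. Proof. by case: g_omits. Qed.
Let gy h : g h != y. Proof. by case: g_omits. Qed.
Let g_im z : z != x -> z != y -> exists h, g h = z.
Proof. by case: g_omits => _ _ _; apply. Qed.

Lemma omits_isomorphic : isomorphic G (delete2 x y).
Proof.
have g_in h : g h \in ~: [set x; y] by rewrite !inE negb_or gx gy.
have g_inj : injective g.
  by move=> h h' gh; apply: (cubical_inj g_cub); rewrite gh.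
exists (fun h => exist _ (g h) (g_in h)); split=> [|h h']; last first.
  rewrite (cubical_edge g_cub) -(cubical_edge (@B_cubical r s)); exact: erefl.
apply: inj_card_bij => [h h' [/g_inj]//|].
rewrite card_sig -(card_imset _ g_inj); apply/subset_leq_card/subsetP=> z.
rewrite !inE negb_or => /andP[zx zy]; have [h <-] := g_im zx zy.
exact: imset_f.
Qed.

(** The neighbours [0] and [2] of a [1] have no other common neighbour. *)
Lemma omits_mid i : x.1 i = mid -> exists o, y = set3 x i (tip o).
Proof.
move=> xi.
have [y0|y0] := eqVneq y (set3 x i (tip false)); first by exists false.
have [y1|y1] := eqVneq y (set3 x i (tip true)); first by exists true.
have tip_x o : set3 x i (tip o) != x.
  by apply: (neq3 (i := i)); rewrite set3_same xi tip_mid.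
rewrite eq_sym in y0; rewrite eq_sym in y1.
have [u def_u] := g_im (tip_x false) y0.
have [v def_v] := g_im (tip_x true) y1.
have u_v : u != v.
  apply/eqP=> u_v; have := set3_same x i (tip false).
  by rewrite -def_u u_v def_v set3_same.
have [w [k [_ def_w]]] := cubical_step g_cub u_v.
rewrite def_u in def_w *; rewrite def_v.
case: k def_w => [[i' b]|j] def_w; last by rewrite !codebit /= eqxx.
rewrite !codeP3 !set3E; have [ii|] := eqVneq i' i; last by rewrite eqxx.
rewrite {i'}ii in def_w *; case: b def_w => def_w _.
  have := @code_excl _ _ (g w) i false.
  rewrite /= def_w flip_eq flip_neq; last by apply/eqP=> -[].
  by rewrite !codeP3 set3_same => /(_ isT).
have := gx w; case/eqP; apply: code_inj; rewrite def_w -code_set_mid ?set3_same //.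
by congr code; apply: B_ext => // i''; rewrite !set3E; case: eqVneq => [->|_] //; rewrite xi.
Qed.

Lemma omits_not_corner : ~ corner x -> exists i o, P3_edge_at x y i o.
Proof.
move=> ncx; have [i /eqP xi|no_mid] := pickP (fun i => x.1 i == mid); last first.
  by case: ncx; apply/cornerP=> i; rewrite no_mid.
have [o def_y] := omits_mid xi; exists i, o; split=> // i' ii; apply/eqP=> xi'.
have [o' def_y'] := omits_mid xi'; have := set3_same x i (tip o).
by rewrite -def_y def_y' set3E eq_sym (negPf ii) xi; case: (o).
Qed.

(** [daisy_of_star] read in [B r s]; words between two codes are codes under the
first condition. *)
Lemma daisy_of_box v : 0 < #|G| ->
  (forall (h : G) i, v.1 i = mid \/ v.1 i = (g h).1 i) ->
  (forall (h : G) z, in_box (g h) v z -> z != x /\ z != y) ->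
  is_daisy_cube G.
Proof.
move=> G_gt0 v_or box; apply: (daisy_of_star (phi := fun h => code (g h)) (c := code v)).
- by [].
- exact: cubical_inj g_cub.
- exact: cubical_edge g_cub.
move=> u w /(between_code (v_or u))[z <- /box[zx zy]].
by have [h <-] := g_im zx zy; exists h.
Qed.

(** With the bits of the centre complementary to those of [x], nothing lies
behind [x], and nothing but possibly [x] lies behind [y]. *)
Lemma corners_daisy : 0 < #|G| -> corner x -> corner y ->
  q_diff x y = 0 \/ (p_diff x y = 0 /\ q_diff x y = 1) -> is_daisy_cube G.
Proof.
move=> G_gt0 cx cy xy; pose v := center [ffun j => ~~ x.2 j].
apply: (daisy_of_box (v := v)) => // [u i|u z box]; first by left; rewrite center1.
have cE (t : B r s) i : corner t -> t.1 i != v.1 i.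
  by move=> /cornerP/(_ i); rewrite center1.
have xE j : x.2 j != v.2 j by rewrite /= ffunE; case: (x.2 j).
have z_x : z != x.
  apply: contraNneq (gx u) => z_x; apply/eqP.
  by rewrite -z_x; apply: (box_apex box) => [i|j]; rewrite z_x // cE.
split=> //; have [|[/(p_diff0P cx cy) p0 /q_diff1P[j q1]]] := xy.
  move/q_diff0P=> q0; apply: contraNneq (gy u) => z_y; apply/eqP.
  by rewrite -z_y; apply: (box_apex box) => [i|j]; rewrite z_y -?q0 // cE.
apply/eqP=> z_y; case: (box); rewrite z_y => box1 box2.
have u1 i : (g u).1 i = y.1 i.
  by have [->//|yv] := box1 i; have := cE y i cy; rewrite yv eqxx.
have u2 j' : j' != j -> (g u).2 j' = y.2 j'.
  move=> jj; have [->//|yv] := box2 j'; have := xE j'.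
  by rewrite -yv q1 (negPf jj) addbF eqxx.
have [uj|uj] := eqVneq ((g u).2 j) (y.2 j).
  case/eqP: (gy u); apply: B_ext => // j'.
  by have [->|/u2] := eqVneq j' j.
case/eqP: (gx u); apply: B_ext => [i|j']; first by rewrite u1 p0.
have [->|jj] := eqVneq j' j; last by rewrite u2 // q1 (negPf jj) addbF.
by move: uj; rewrite q1 eqxx; case: ((g u).2 j); case: (x.2 j).
Qed.

(** The vertices beside [x] and [y] along a bit in which these differ are present
unless one of them is [y] or [x]. *)
Lemma corners_flips : corner x -> corner y ->
  ~ (q_diff x y = 0 \/ (p_diff x y = 0 /\ q_diff x y = 1)) ->
  exists j (a b : G), [/\ x.2 j != y.2 j, g a = flip2 x j & g b = flip2 y j].
Proof.
move=> cx cy not_xy.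
have [j x_y|eq_xy] := pickP (fun j => x.2 j != y.2 j); last first.
  by case: not_xy; left; apply/q_diff0P=> j; apply/eqP/negbFE/eq_xy.
have flip_neq z : flip2 z j != z.
  by apply: (neq2 (j := j)); rewrite flip2E eqxx; case: (z.2 j).
have fx_y : flip2 x j != y.
  apply/eqP=> fx_y; case: not_xy; right; split.
    by apply/p_diff0P=> // i; rewrite -fx_y.
  by apply/q_diff1P; exists j => j'; rewrite -fx_y flip2E.
have [a ga] := g_im (flip_neq x) fx_y.
have [|b gb] := g_im _ (flip_neq y).
  by apply: contraNneq fx_y => <-; rewrite flip2K.
by exists j, a, b.
Qed.

Lemma not_flip_back (u : G) z j : z != g u -> code (g u) != flip (inr j) (code (flip2 z j)).
Proof.
by rewrite -code_flip2 flip2K; apply: contraNneq => /code_inj->.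
Qed.

Lemma corners_not_daisy : corner x -> corner y ->
  ~ (q_diff x y = 0 \/ (p_diff x y = 0 /\ q_diff x y = 1)) -> ~ is_daisy_cube G.
Proof.
move=> cx cy /(corners_flips cx cy)[j [a [b [x_y ga gb]]]].
apply: (not_daisy (l := inr j) (a := a) (b := b) g_cub) => [|w|w].
- by rewrite !codebit ga gb !flip2E (inj_eq (@addIb _)).
- by rewrite ga not_flip_back // eq_sym.
by rewrite gb not_flip_back // eq_sym.
Qed.

(** A coordinate in which [x] and [y] agree defines a restriction that keeps the
obstruction. *)
Lemma corners_minimal : corner x -> corner y -> minimal_forbidden_pc_minor G ->
  ~ (q_diff x y = 0 \/ (p_diff x y = 0 /\ q_diff x y = 1)) ->
  p_diff x y = r /\ q_diff x y = s.
Proof.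
move=> cx cy min_G /(corners_flips cx cy)[j [a [b [x_y ga gb]]]].
have ab_j : code (g a) (inr j) != code (g b) (inr j).
  by rewrite !codebit ga gb !flip2E (inj_eq (@addIb _)).
have no_a w : code (g w) != flip (inr j) (code (g a)).
  by rewrite ga not_flip_back // eq_sym.
have no_b w : code (g w) != flip (inr j) (code (g b)).
  by rewrite gb not_flip_back // eq_sym.
split; apply/eqP; apply: contraT.
  case/(p_diff_neq cx cy)=> i eq_xy; have [b0 xi] := corner_tip i cx.
  have ai : (g a).1 i = tip b0 by rewrite ga.
  have mid_neq z : z.1 i = tip b0 -> set3 (g a) i mid != z.
    by move=> zi; apply: (neq3 (i := i)); rewrite set3_same zi eq_sym tip_mid.
  have [c gc] := g_im (mid_neq x xi) (mid_neq y (etrans (esym eq_xy) xi)).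
  case: (not_minimal (a := a) (b := c) (k := inl (i, b0)) g_cub _ _ _ ab_j no_a no_b min_G) => //.
    by rewrite gc -code_set_mid.
  by rewrite !codeP3 ga gb /= eq_xy.
case/q_diff_neq=> j' eq_xy.
have jj : j' != j by apply: contraNneq x_y => <-; rewrite eq_xy.
have fl_neq z : z.2 j' = x.2 j' -> flip2 (g a) j' != z.
  move=> zj; apply: (neq2 (j := j')).
  by rewrite flip2E eqxx ga flip2E (negPf jj) addbF zj; case: (x.2 j').
have [c gc] := g_im (fl_neq x erefl) (fl_neq y (esym eq_xy)).
case: (not_minimal (a := a) (b := c) (k := inr j') g_cub _ _ _ ab_j no_a no_b min_G) => //.
  by rewrite gc -code_flip2.
by rewrite !codebit ga gb !flip2E (negPf jj) eq_xy.
Qed.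

Section BoundaryEdge.
Variables (i : 'I_r) (o : bool).
Hypothesis xy_edge : P3_edge_at x y i o.

Let xi : x.1 i = mid. Proof. by case: xy_edge. Qed.
Let x_rest i' : i' != i -> x.1 i' != mid. Proof. by case: xy_edge => _ + _; apply. Qed.
Let def_y : y = set3 x i (tip o). Proof. by case: xy_edge. Qed.
Let yi : y.1 i = tip o. Proof. by rewrite def_y set3_same. Qed.

Lemma edge_apex : exists a, g a = set3 x i (tip (~~ o)).
Proof.
apply: g_im; apply: (neq3 (i := i)); rewrite set3_same ?xi ?tip_mid //.
by rewrite yi (inj_eq tip_inj); case: (o).
Qed.

Lemma edge_no_apex (a : G) : g a = set3 x i (tip (~~ o)) ->
  forall w, code (g w) != flip (inl (i, ~~ o)) (code (g a)).
Proof.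
move=> -> w; rewrite code_set3 // flipK.
by apply: contraNneq (gx w) => /code_inj->.
Qed.

(** The flipped word would claim both tips of the path in direction [i]. *)
Lemma edge_no_other (b : G) : (g b).1 i = tip o ->
  forall w, code (g w) != flip (inl (i, ~~ o)) (code (g b)).
Proof.
move=> bi w; apply/eqP=> def_w; have := @code_excl _ _ (g w) i o.
have oo : (i, ~~ o) != (i, o) by apply/eqP=> -[]; case: (o).
rewrite def_w flip_eq flip_neq; last by apply: contraNneq oo => -[<-].
rewrite !codeP3 bi eqxx (inj_eq tip_inj) => /(_ isT).
by case: (o).
Qed.

Lemma edge_sides (a b : G) : g a = set3 x i (tip (~~ o)) -> (g b).1 i = tip o ->
  code (g a) (inl (i, ~~ o)) != code (g b) (inl (i, ~~ o)).
Proof.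
by move=> -> bi; rewrite !codeP3 set3_same bi eqxx (inj_eq tip_inj); case: (o).
Qed.

Lemma edge_not_daisy : (exists i', i' != i) \/ 0 < s -> ~ is_daisy_cube G.
Proof.
move=> big; have [a ga] := edge_apex.
suff [b bi] : exists b, (g b).1 i = tip o.
  exact: (not_daisy g_cub (edge_sides ga bi) (edge_no_apex ga) (edge_no_other bi)).
have not_x z : z.1 i = tip o -> z != x.
  by move=> zi; apply: (neq3 (i := i)); rewrite zi xi tip_mid.
case: big => [[i' ii]|s_gt0].
  have [||b gb] := g_im (z := set3 y i' mid).
  - by apply: not_x; rewrite set3E eq_sym (negPf ii).
  - apply: (neq3 (i := i')); rewrite set3_same def_y set3E (negPf ii) eq_sym.
    exact: x_rest.
  by exists b; rewrite gb set3E eq_sym (negPf ii).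
have [||b gb] := g_im (z := flip2 y (Ordinal s_gt0)).
- exact: not_x.
- by apply: (neq2 (j := (Ordinal s_gt0))); rewrite flip2E eqxx; case: (y.2 _).
by exists b; rewrite gb.
Qed.

(** In a second ternary direction [i'] the restriction leaves out the tip away from
the edge rather than keeping the tip of the edge: this leaves room for a vertex
on the side of [y] even when [i] and [i'] are the only coordinates. *)
Lemma edge_not_minimal : (exists i', i' != i) \/ 1 < s ->
  ~ minimal_forbidden_pc_minor G.
Proof.
move=> big; have [a ga] := edge_apex.
have not_x z b : z.1 i = tip b -> z != x.
  by move=> zi; apply: (neq3 (i := i)); rewrite zi xi tip_mid.
have not_y z : z.1 i = tip (~~ o) -> z != y.
  by move=> zi; apply: (neq3 (i := i)); rewrite zi yi (inj_eq tip_inj); case: (o).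
have ai : (g a).1 i = tip (~~ o) by rewrite ga set3_same.
case: big => [[i' ii]|s_gt1].
  have ii' : (i == i') = false by rewrite eq_sym (negPf ii).
  have [b1 xi'] : exists b1, x.1 i' = tip b1.
    by have [xi'|//] := tipP (x.1 i'); have := x_rest ii; rewrite xi' eqxx.
  have ai' : (g a).1 i' = tip b1 by rewrite ga set3E (negPf ii).
  have in_G t : exists c, g c = set3 (g a) i' t.
    apply: g_im; [apply: (@not_x _ (~~ o)) | apply: not_y]; by rewrite set3E ii'.
  have [c gc] := in_G mid; have [d gd] := in_G (tip (~~ b1)).
  have [||b gb] := g_im (z := set3 y i' mid).
  - by apply: (@not_x _ o); rewrite set3E ii'.
  - apply: (neq3 (i := i')); rewrite set3_same def_y set3E (negPf ii) eq_sym.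
    exact: x_rest.
  have bi : (g b).1 i = tip o by rewrite gb set3E ii'.
  apply: (not_minimal (a := c) (b := d) (k := inl (i', ~~ b1)) g_cub _ _ _
    (edge_sides ga bi) (edge_no_apex ga) (edge_no_other bi)).
  - rewrite gd gc -code_set3 ?set3_same //; congr code; apply: B_ext => // i''.
    by rewrite !set3E; case: eqVneq.
  - by rewrite !codeP3 ai' gc set3_same [mid == _]eq_sym tip_mid (inj_eq tip_inj); case: (b1).
  by rewrite !codeP3 gb gc !set3_same.
(* Restrict along one bit and use another to step aside from [y]. *)
have [j [j' jj]] : exists j j' : 'I_s, j' != j.
  by exists (Ordinal (ltnW s_gt1)), (Ordinal s_gt1).
have [||c gc] := g_im (z := flip2 (g a) j).
- exact: (not_x (flip2 (g a) j) _ ai).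
- exact: (not_y (flip2 (g a) j) ai).
have [||b gb] := g_im (z := flip2 y j').
- exact: (not_x (flip2 y j') _ yi).
- by apply: (neq2 (j := j')); rewrite flip2E eqxx; case: (y.2 _).
have bi : (g b).1 i = tip o by rewrite gb.
apply: (not_minimal (a := a) (b := c) (k := inr j) g_cub _ _ _
  (edge_sides ga bi) (edge_no_apex ga) (edge_no_other bi)) => //.
  by rewrite gc code_flip2.
by rewrite !codebit gb ga flip2E eq_sym (negPf jj) addbF def_y.
Qed.

Lemma edge_daisy : 0 < #|G| -> r = 1 -> s = 0 -> is_daisy_cube G.
Proof.
move=> G_gt0 r1 s0; have [a ga] := edge_apex.
have only_i i' : i' = i.
  by apply: val_inj; have := ltn_ord i'; have := ltn_ord i; rewrite /=; lia.
have ext u v : u.1 i = v.1 i -> u = v.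
  move=> uv; apply: B_ext => [i'|j]; first by rewrite (only_i i').
  by have := ltn_ord j; lia.
have all_a (u : G) : g u = g a.
  apply: (ext); have [ui|[b ui]] := tipP ((g u).1 i).
    by case/eqP: (gx u); apply: (ext); rewrite ui xi.
  have [bo|bo] := eqVneq b o.
    by case/eqP: (gy u); apply: (ext); rewrite ui yi bo.
  by rewrite ui ga set3_same; congr tip; move: bo; case: (b); case: (o).
apply: (daisy_of_box (v := g a)) => // [u i'|u z [box1 box2]].
  by right; rewrite all_a.
suff -> : z = g a by rewrite gx gy.
by apply: B_ext => k; [have [] := box1 k | have [] := box2 k]; rewrite ?all_a.
Qed.

End BoundaryEdge.

(** * Two opposite corners *)

Section Opposite.
Hypothesis xy_opp : opposite_corners x y.

(** The side of [x] omits [x] only, and [x] is an apex seen from any centre [v] in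
this side that agrees with [x] just where the side forces it to. *)
Lemma restriction_of_center v k (a b : G) :
  code (g b) = flip k (code (g a)) -> code x k = code (g a) k ->
  code v k = code (g a) k ->
  (forall i, v.1 i = mid \/ forall u, code u k = code (g a) k -> u.1 i = v.1 i) ->
  (forall j, v.2 j != x.2 j \/ forall u, code u k = code (g a) k -> u.2 j = v.2 j) ->
  is_daisy_cube (restriction a b).
Proof.
move=> def_b xk vk v1 v2.
have /cornerP cx : corner x by case: xy_opp.
apply: (restriction_daisy g_cub def_b (c := code v)) => u w uk uw.
have [|z def_w box] := between_code _ uw.
  by move=> i; have [|/(_ _ uk)] := v1 i; auto.
have zk : code z k = code (g a) k.
  by rewrite def_w; have [->|->] := uw k; rewrite ?uk.
have zy : z != y.
  by apply: contra_eqN zk => /eqP->; rewrite (opposite_code xy_opp) xk; case: (code _ _).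
have zx : z != x.
  apply: contraNneq (gx u) => z_x; apply/eqP; move: box; rewrite z_x => -[box1 box2].
  apply: B_ext => [i|j].
    have [//|xv] := box1 i; have [vm|/(_ _ uk)->//] := v1 i.
    by have := cx i; rewrite xv vm eqxx.
  have [//|xv] := box2 j; have [|/(_ _ uk)->//] := v2 j.
  by rewrite xv eqxx.
by have [h gh] := g_im zx zy; exists h; rewrite gh.
Qed.

Lemma opposite_restriction_side k (a b : G) :
  code (g b) = flip k (code (g a)) -> code x k = code (g a) k ->
  is_daisy_cube (restriction a b).
Proof.
move=> def_b xk; pose v := center [ffun j => ~~ x.2 j].
have v2 j : v.2 j != x.2 j by rewrite /= ffunE; case: (x.2 j).
case: k def_b xk => [[i b0]|j] def_b xk.
  case ak: (code (g a) (inl (i, b0))) xk => xk.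
    apply: (restriction_of_center (v := set3 v i (tip b0)) def_b); rewrite ?ak //.
    - by rewrite codeP3 set3_same eqxx.
    - move=> i'; rewrite set3E; case: eqVneq => [->|_]; last by left; rewrite center1.
      by right=> u; rewrite codeP3 => /eqP.
    by move=> j; left; apply: v2.
  apply: (restriction_of_center (v := v) def_b); rewrite ?ak //.
  - by rewrite codeP3 center1 eq_sym tip_mid.
  - by move=> i'; left; apply: center1.
  by move=> j; left; apply: v2.
have vj : (flip2 v j).2 j = x.2 j.
  by rewrite flip2E eqxx; have := v2 j; case: (v.2 j); case: (x.2 j).
apply: (restriction_of_center (v := flip2 v j) def_b) => // [|i|j'].
- by rewrite codebit vj -codebit.
- by left; apply: center1.
have [->|jj] := eqVneq j' j; last by left; rewrite flip2E (negPf jj) addbF v2.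
by right=> u uj; rewrite vj -!codebit uj xk.
Qed.

(** Contracting the edges at the tip of [x] merges [x] with its neighbour, which is
present, so that only [y] remains omitted. *)
Lemma opposite_contraction_tip i b0 (a b : G) :
  code (g b) = flip (inl (i, b0)) (code (g a)) -> code x (inl (i, b0)) ->
  is_daisy_cube (contraction a b).
Proof.
move=> def_b xi; pose v := center x.2.
have cy : corner y by case: xy_opp.
have vi : code v (inl (i, b0)) = false by rewrite codeP3 center1 eq_sym tip_mid.
apply: (contraction_daisy g_cub def_b (c := code v)) => u w uw.
pose w' : {ffun ('I_r * bool) + 'I_s -> bool} :=
  [ffun l => if l == inl (i, b0) then false else w l].
have uw' : between (code (g u)) (code v) w'.
  by move=> l; rewrite ffunE; case: eqVneq => [->|_]; [right; rewrite vi | apply: uw].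
have [|z def_w box] := between_code _ uw'; first by move=> i'; left; apply: center1.
have zx : z != x.
  apply: contraTneq xi => <-; by rewrite def_w ffunE eqxx.
have zy : z != y.
  apply: contraNneq (gy u) => z_y; apply/eqP.
  rewrite -z_y; apply: (box_apex box) => [i'|j]; rewrite z_y.
    by rewrite center1; apply/cornerP: i'.
  rewrite -!codebit (opposite_code xy_opp) [in X in _ != X]codebit codebit /=.
  by case: (x.2 j).
have [h gh] := g_im zx zy; exists h => l lk.
by rewrite gh def_w ffunE (negPf lk).
Qed.

Lemma opposite_flip2 j : 3 <= 2 * r + s -> flip2 x j != y.
Proof.
move=> big; apply/eqP=> fx_y.
have [k kj] : exists k : ('I_r * bool) + 'I_s, k != inr j.
  have [r0|r_gt0] := posnP r; last by exists (inl (Ordinal r_gt0, true)).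
  have s_gt1 : 1 < s by lia.
  have [j0|j0] := eqVneq j (Ordinal s_gt1); last first.
    by exists (inr (Ordinal s_gt1)); apply: contraNneq j0 => -[->].
  by exists (inr (Ordinal (ltnW s_gt1))); rewrite j0; apply/eqP=> -[].
have := opposite_code xy_opp k; rewrite -fx_y code_flip2 flip_neq //.
by case: (code _ _).
Qed.

(** Contracting a bit merges each of [x] and [y] with a neighbour that is present:
the contraction is a full product. *)
Lemma opposite_contraction_bit j (a b : G) : 3 <= 2 * r + s ->
  (flip2 y j != x) ->
  code (g b) = flip (inr j) (code (g a)) -> is_daisy_cube (contraction a b).
Proof.
move=> big fy_x def_b; have fx_y := opposite_flip2 j big.
apply: (contraction_daisy g_cub def_b (c := code (center x.2))) => u w uw.
have [|z def_w _] := between_code _ uw; first by move=> i'; left; apply: center1.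
have flipz : flip2 z j != z by apply: (neq2 (j := j)); rewrite flip2E eqxx; case: (z.2 j).
have [[zx zy]|[zx zy]] : (z != x /\ z != y) \/ (flip2 z j != x /\ flip2 z j != y).
  have [z_x|zx] := eqVneq z x; first by right; rewrite z_x in flipz *.
  have [z_y|zy] := eqVneq z y; first by right; rewrite z_y in flipz *.
  by left.
- by have [h gh] := g_im zx zy; exists h => l _; rewrite gh def_w.
have [h gh] := g_im zx zy; exists h => l lj.
by rewrite gh code_flip2 flip_neq // def_w.
Qed.

End Opposite.
End Fixed.

(** Restricting to either side of a class keeps only one of the two omitted
corners, and contracting a class fills in at least one of them. *)
Lemma opposite_minimal (G : sgraph) (g : G -> B r s) x y :
  0 < #|G| -> omits g x y -> opposite_corners x y -> 3 <= 2 * r + s ->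
  ~ is_daisy_cube G -> minimal_forbidden_pc_minor G.
Proof.
move=> G_gt0 g_om xy_opp big not_d; have g_cub : cubical (fun h => code (g h)).
  by case: g_om.
have yx_opp := opposite_sym xy_opp; have g_om' := omits_sym g_om.
apply: minimal_forbiddenI => // [|a b ab|a b ab].
- exact: partial_cubeI G_gt0 g_cub.
- have [k def_b] := cubical_edgeP g_cub _ _ ab.
  have [xk|xk] := eqVneq (code x k) (code (g a) k).
    exact: (opposite_restriction_side g_om xy_opp def_b xk).
  apply: (opposite_restriction_side g_om' yx_opp def_b).
  by rewrite (opposite_code xy_opp); case: (code x k) xk; case: (code (g a) k).
have [[[i b0]|j] def_b] := cubical_edgeP g_cub _ _ ab; last first.
  by apply: (opposite_contraction_bit g_om xy_opp big _ def_b); apply: opposite_flip2.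
case xi: (code x (inl (i, b0))).
  exact: (opposite_contraction_tip g_om xy_opp def_b).
apply: (opposite_contraction_tip g_om' yx_opp def_b).
by rewrite (opposite_code xy_opp) xi.
Qed.

(** A square without two opposite vertices is disconnected. *)
Lemma opposite_square (G : sgraph) (g : G -> B r s) x y :
  omits g x y -> opposite_corners x y -> r = 0 -> s = 2 -> False.
Proof.
move=> [g_cub gx gy g_im] xy_opp r0 s2.
have flipx z j : flip2 z j != z.
  by apply: (neq2 (j := j)); rewrite flip2E eqxx; case: (z.2 j).
have y2 j : y.2 j = ~~ x.2 j by rewrite -!codebit (opposite_code xy_opp).
have s_gt1 : 1 < s by rewrite s2.
pose j0 := Ordinal (ltnW s_gt1); pose j1 := Ordinal s_gt1.
have jE j : j = j0 \/ j = j1.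
  case: j => -[|[|m]] lt_m; [left | right |]; try exact: val_inj.
  by exfalso; lia.
have fx_y : flip2 x j0 != y.
  by apply: (neq2 (j := j1)); rewrite flip2E y2 addbF; case: (x.2 j1).
have fx_x : flip2 x j1 != y.
  by apply: (neq2 (j := j0)); rewrite flip2E y2 addbF; case: (x.2 j0).
have [u gu] := g_im _ (flipx x j0) fx_y; have [v gv] := g_im _ (flipx x j1) fx_x.
have u_v : u != v.
  apply/eqP=> u_v; have : (flip2 x j0).2 j0 = (flip2 x j1).2 j0 by rewrite -gu u_v gv.
  by rewrite !flip2E /=; case: (x.2 j0).
have [w [[[i b]|j] [_ def_w _]]] := cubical_step g_cub u_v.
  by have := ltn_ord i; lia.
move: def_w; rewrite gu -code_flip2 => /code_inj.
have [->|->] := jE j; first by rewrite flip2K => /eqP; rewrite (negPf (gx w)).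
suff -> : flip2 (flip2 x j0) j1 = y by move/eqP; rewrite (negPf (gy w)).
apply: B_ext => [i|j']; first by have := ltn_ord i; lia.
by rewrite !flip2E y2; have [->|->] := jE j'; case: (x.2 _).
Qed.

End Omits.

(** * The exceptional boundary edge *)
Lemma ham_B11 (u v : B 1 1) :
  ham (code u) (code v) =
    ((u.1 ord0 == tip true) != (v.1 ord0 == tip true)) +
    ((u.1 ord0 == tip false) != (v.1 ord0 == tip false)) +
    (u.2 ord0 != v.2 ord0).
Proof.
have sum_pair (F : 'I_1 * bool -> nat) :
    \sum_p F p = F (ord0, true) + F (ord0, false).
  have -> : \sum_p F p = \sum_i \sum_b F (i, b).
    by rewrite pair_big; apply: eq_bigr => -[].
  by rewrite big_ord1 big_bool.
rewrite /ham -sum1dep_card big_mkcond big_sumType /= sum_pair big_ord1.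
rewrite !codeP3 !codebit.
by congr (_ + _ + _); case: ifP.
Qed.

(** In [B 1 1] a boundary edge [xy] leaves a path on four vertices; moving its
vertex opposite to [y] to the vacant place [x] preserves all distances. *)
Lemma omits_edge11 (G : sgraph) (g : G -> B 1 1) x y i o :
  omits g x y -> P3_edge_at x y i o ->
  exists (g' : G -> B 1 1) z, omits g' y z /\ opposite_corners y z.
Proof.
rewrite (ord1 i) => -[g_cub gx gy g_im] [xi _ def_y].
pose z := flip2 (set3 x ord0 (tip (~~ o))) ord0.
have ext (u v : B 1 1) : u.1 ord0 = v.1 ord0 -> u.2 ord0 = v.2 ord0 -> u = v.
  by move=> uv1 uv2; apply: B_ext => k; rewrite (ord1 k).
have y1 : y.1 ord0 = tip o by rewrite def_y set3_same.
have y2 : y.2 ord0 = x.2 ord0 by rewrite def_y.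
have z1 : z.1 ord0 = tip (~~ o) by rewrite set3_same.
have z2 : z.2 ord0 = ~~ x.2 ord0 by rewrite flip2E addbT.
have xz : x != z by apply: (neq3 (i := ord0)); rewrite xi z1 eq_sym tip_mid.
have yz : y != z.
  by apply: (neq3 (i := ord0)); rewrite y1 z1 (inj_eq tip_inj); case: (o).
have yx : y != x by apply: (neq3 (i := ord0)); rewrite xi y1 tip_mid.
have move_z (u : B 1 1) : u != x -> u != y -> u != z ->
    ham (code u) (code z) = ham (code u) (code x).
  move=> ux uy uz; rewrite !ham_B11 xi z1 z2 ![mid == _]eq_sym !tip_mid.
  rewrite !(inj_eq tip_inj).
  (* Each value of the ternary coordinate leaves a single vertex [u]. *)
  have [um|[b ub]] := tipP (u.1 ord0).
    rewrite um ![mid == _]eq_sym !tip_mid.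
    have -> : u.2 ord0 = ~~ x.2 ord0.
      apply/eqP; apply: contraNT ux => u2; apply/eqP/ext; rewrite ?xi //.
      by move: u2; case: (u.2 _); case: (x.2 _).
    by case: (x.2 _); case: (o).
  rewrite ub !(inj_eq tip_inj); have [bo|bo] := eqVneq b o.
    have -> : u.2 ord0 = ~~ x.2 ord0.
      apply/eqP; apply: contraNT uy => u2; apply/eqP/ext; rewrite ?y1 ?y2 ?ub ?bo //.
      by move: u2; case: (u.2 _); case: (x.2 _).
    by rewrite bo; case: (x.2 _); case: (o).
  have {}bo : b = ~~ o by move: bo; case: (b); case: (o).
  have -> : u.2 ord0 = x.2 ord0.
    apply/eqP; apply: contraNT uz => u2; apply/eqP/ext; rewrite ?z1 ?z2 ?ub ?bo //.
    by move: u2; case: (u.2 _); case: (x.2 _).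
  by rewrite bo; case: (x.2 _); case: (o).
pose g' h := if g h == z then x else g h.
exists g', z; split; last first.
  have cy : corner y by apply/cornerP=> k; rewrite (ord1 k) y1 tip_mid.
  have cz : corner z by apply/cornerP=> k; rewrite (ord1 k) z1 tip_mid.
  split=> //.
    rewrite /p_diff (eq_card (B := setT)) ?cardsT ?card_ord // => k.
    rewrite !inE set02_neq // (ord1 k) y1 z1 (inj_eq tip_inj).
    by case: (o).
  rewrite /q_diff (eq_card (B := setT)) ?cardsT ?card_ord // => k.
  by rewrite !inE (ord1 k) y2 z2; case: (x.2 _).
split=> [u v|h|h|t ty tz].
- rewrite g_cub; congr Some; rewrite /g'.
  case: (eqVneq (g u) z) (eqVneq (g v) z) => [gu|gu] [gv|gv] //.
  + by rewrite gu gv !hamxx.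
  + by rewrite gu hamC move_z // hamC.
  by rewrite gv move_z.
- by rewrite /g'; case: ifP => _; rewrite ?gy // eq_sym.
- by rewrite /g'; case: ifPn.
have [->|tx] := eqVneq t x.
  rewrite eq_sym in xz; rewrite eq_sym in yz; have [h gh] := g_im z xz yz.
  by exists h; rewrite /g' gh eqxx.
by have [h gh] := g_im t tx ty; exists h; rewrite /g' gh (negPf tz).
Qed.

(** * Classification of the isometric deletions *)

Lemma omits_delete2 r s (x y : B r s) :
  isometric_subgraph (val : delete2 x y -> B r s) ->
  omits (val : delete2 x y -> B r s) x y.
Proof.
case=> _ _ iso; split=> [u v|h|h|z zx zy].
- by rewrite iso B_cubical.
- by have := valP h; rewrite !inE negb_or => /andP[].
- by have := valP h; rewrite !inE negb_or => /andP[].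
have z_in : z \in ~: [set x; y] by rewrite !inE negb_or zx zy.
by exists (exist _ z z_in).
Qed.

Lemma omits_cases r s (G : sgraph) (g : G -> B r s) x y : omits g x y ->
  [\/ corner x /\ corner y, exists i o, P3_edge_at x y i o
    | exists i o, P3_edge_at y x i o].
Proof.
move=> g_om.
have [/forallP cx|/forallPn[i xi]] := boolP [forall i, x.1 i != mid]; last first.
  constructor 2; apply: (omits_not_corner g_om) => /cornerP/(_ i).
  exact/negP.
have [/forallP cy|/forallPn[i yi]] := boolP [forall i, y.1 i != mid]; last first.
  constructor 3; apply: (omits_not_corner (omits_sym g_om)) => /cornerP/(_ i).
  exact/negP.
by constructor 1; split; apply/cornerP.
Qed.

Lemma other_ord r (i : 'I_r) : r <> 1 -> exists i' : 'I_r, i' != i.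
Proof.
move=> r1; have [i' ii|all_i] := pickP (fun i' => i' != i); first by exists i'.
case: r1; rewrite -(card_ord r) -(cards1 i) -cardsT; apply: eq_card => i'.
by rewrite !inE; have /negbFE-> := all_i i'.
Qed.

Section BoundaryCase.
Variables (r s : nat) (G : sgraph) (g : G -> B r s) (x y : B r s).
Variables (i : 'I_r) (o : bool).
Hypotheses (g_om : omits g x y) (xy_edge : P3_edge_at x y i o).
Hypothesis G_gt0 : 0 < #|G|.

Lemma edge_daisyE : is_daisy_cube G <-> r = 1 /\ s = 0.
Proof.
split=> [G_d|[r1 s0]]; last exact: (edge_daisy g_om xy_edge).
have [r1|/eqP/(other_ord i) r1] := eqVneq r 1; last first.
  by case: (edge_not_daisy g_om xy_edge (or_introl r1)).
by have [//|s_gt0] := posnP s; case: (edge_not_daisy g_om xy_edge (or_intror s_gt0)).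
Qed.

Lemma edge_minimalE : minimal_forbidden_pc_minor G <-> r = 1 /\ s = 1.
Proof.
split=> [G_min|[r1 s1]].
  have [r1|/eqP/(other_ord i) r1] := eqVneq r 1; last first.
    by case: (edge_not_minimal g_om xy_edge (or_introl r1)).
  split=> //; have [s_gt1|] := ltnP 1 s.
    by case: (edge_not_minimal g_om xy_edge (or_intror s_gt1)).
  have [s0|] := posnP s; last by lia.
  by case: G_min => _ not_d _; case: not_d; apply/edge_daisyE.
have not_d : ~ is_daisy_cube G by case/edge_daisyE => _; rewrite s1.
move: g x y i g_om xy_edge; rewrite r1 s1 => g' x' y' i' g'_om x'y'_edge.
have [g2 [z [g2_om yz_opp]]] := omits_edge11 g'_om x'y'_edge.
exact: (opposite_minimal G_gt0 g2_om yz_opp).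
Qed.

Lemma edge_minimal_opposite : minimal_forbidden_pc_minor G ->
  exists (r' s' : nat) (x' y' : B r' s'),
    [/\ x' <> y', opposite_corners x' y' & isomorphic G (delete2 x' y')].
Proof.
case/edge_minimalE=> r1 s1.
move: g x y i g_om xy_edge; rewrite r1 s1 => g' x' y' i' g'_om x'y'_edge.
have [g2 [z [g2_om yz_opp]]] := omits_edge11 g'_om x'y'_edge.
exists 1, 1, y', z; split=> //; last exact: omits_isomorphic g2_om.
move=> yz; have := opposite_code yz_opp (inr ord0); rewrite yz.
by case: (code _ _).
Qed.

End BoundaryCase.

Theorem theorem19 (r s : nat) (x y : B r s)
    (hxy : x <> y)
    (hne : 0 < #|delete2 x y|)
    (hiso : @isometric_subgraph (delete2 x y) (B r s) val) :
  [/\ is_daisy_cube (delete2 x y) <->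
        (corner x /\ corner y /\
           (q_diff x y = 0 \/ (p_diff x y = 0 /\ q_diff x y = 1)))
        \/ (r = 1 /\ s = 0 /\ boundary_P3_edge x y),
      minimal_forbidden_pc_minor (delete2 x y) <->
        (opposite_corners x y /\ 1 <= s /\ 3 <= 2 * r + s)
        \/ (r = 1 /\ s = 1 /\ boundary_P3_edge x y)
    & minimal_forbidden_pc_minor (delete2 x y) ->
        exists (r' s' : nat) (x' y' : B r' s'),
          [/\ x' <> y', opposite_corners x' y'
            & isomorphic (delete2 x y) (delete2 x' y')]].
Proof.
have H_om := omits_delete2 hiso.
have [[cx cy]|edge_xy] : (corner x /\ corner y) \/
    (exists (g : delete2 x y -> B r s) x' y' i o,
      [/\ omits g x' y', P3_edge_at x' y' i o & boundary_P3_edge x y]).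
  case: (omits_cases H_om) => [c_xy|[i [o xy]]|[i [o yx]]]; first by left.
    by right; exists val, x, y, i, o; split=> //; apply: P3_edge_boundary xy.
  right; exists val, y, x, i, o; split=> //; first exact: omits_sym.
  exact: boundary_sym (P3_edge_boundary yx).
- have not_b : ~ boundary_P3_edge x y by move/boundary_not_corners; apply.
  have daisyE : is_daisy_cube (delete2 x y) <->
      q_diff x y = 0 \/ p_diff x y = 0 /\ q_diff x y = 1.
    split; last exact: (corners_daisy H_om).
    move=> H_d; have [/eqP q0|q0] := boolP (q_diff x y == 0); first by left.
    have [/andP[/eqP p0 /eqP q1]|pq] := boolP ((p_diff x y == 0) && (q_diff x y == 1)).
      by right.
    case: (corners_not_daisy H_om cx cy) => // -[q0'|[p0 q1]].
      by rewrite q0' in q0.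
    by rewrite p0 q1 in pq.
  have minE : minimal_forbidden_pc_minor (delete2 x y) <->
      opposite_corners x y /\ 1 <= s /\ 3 <= 2 * r + s.
    split=> [H_min|[xy_opp [s_gt0 big]]]; last first.
      apply: (opposite_minimal hne H_om xy_opp big) => /daisyE.
      by case: xy_opp => _ _ -> ->; lia.
    have not_d : ~ (q_diff x y = 0 \/ p_diff x y = 0 /\ q_diff x y = 1).
      by case: H_min => _ not_d _ /daisyE.
    have [pr qs] := corners_minimal H_om cx cy H_min not_d.
    have xy_opp : opposite_corners x y by [].
    split=> //; rewrite pr qs in not_d.
    have := opposite_square H_om xy_opp; lia.
  split.
  + split=> [/daisyE|[[_ [_ /daisyE//]]|[_ [_ /not_b//]]]]; by left.
  + split=> [/minE|[/minE//|[_ [_ /not_b//]]]]; by left.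
  move=> H_min; have [xy_opp _] := minE.1 H_min.
  by exists r, s, x, y; split=> //; apply: isomorphic_refl.
case: edge_xy => g [x' [y' [i [o [g_om xy_edge b_xy]]]]].
have not_c : corner x -> corner y -> False := boundary_not_corners b_xy.
split; last exact: edge_minimal_opposite g_om xy_edge hne.
- rewrite (edge_daisyE g_om xy_edge hne); split=> [[r1 s0]|]; first by right.
  by case=> [[cx [/(not_c cx)]]|[r1 [s0 _]]].
rewrite (edge_minimalE g_om xy_edge hne); split=> [[r1 s1]|]; first by right.
by case=> [[[cx /(not_c cx)]]|[r1 [s1 _]]].
Qed.
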